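(* Let $d\ge1$, and let $a=(a_1,\dots,a_d)$ and $b=(b_1,\dots,b_d)$ be nonincreasing tuples of dyadic numbers with $a\lesssim b$. Let $g\in SO(d)$ be distributed according to Haar measure. Then \[\mathbb{P}\Big[\big|g[a]\cap[b]\big|\sim|a|\Big]\sim I(a,b),\qquad I(a,b):=\prod_{i,j=1}^d\min(a_i^{-1}b_j,1).\]
   Context: For a nonincreasing dyadic tuple $s=(s_1,\dots,s_d)$, $[s]=[-\tfrac12 s_1,\tfrac12 s_1]\times\cdots\times[-\tfrac12 s_d,\tfrac12 s_d]$ and $|s|=\prod_i s_i$ (its volume). For tuples, $a\lesssim b$ means $a_i\le Cb_i$ for all $i$. All implied constants (in $\lesssim$, $\sim$, including the one defining the event $|g[a]\cap[b]|\sim|a|$) depend only on $d$. *)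

(* Defs.v *)
From HB Require Import structures.
From mathcomp Require Import all_boot all_order all_algebra.
From mathcomp Require Import all_classical all_reals all_analysis.
From mathcomp Require Import Rstruct Rstruct_topology.
Set Implicit Arguments. Unset Strict Implicit. Unset Printing Implicit Defensive.
Import Order.TTheory GRing.Theory Num.Theory.
Import numFieldNormedType.Exports.
Local Open Scope classical_set_scope.
Local Open Scope ring_scope.

Section Defs.
Variable R : realType.

Definition dyadic (x : R) : Prop := exists k : int, x = 2%:R ^ k.

Definition dyadic_tuple d (s : 'I_d -> R) : Prop := forall i, dyadic (s i).

Definition nonincreasing_tuple d (s : 'I_d -> R) : Prop :=
  forall i j : 'I_d, (i <= j)%N -> s j <= s i.

Definition tvol d (s : 'I_d -> R) : R := \prod_(i < d) s i.

Definition box d (s : 'I_d -> R) : set 'cV[R]_d :=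
  [set x | forall i : 'I_d, - (s i / 2) <= x i ord0 <= s i / 2].

(** d-dimensional Lebesgue measure, written out as the iterated
    (Tonelli) integral of the indicator function over R^d. *)
Definition upd (x : nat -> R) (k : nat) (t : R) : nat -> R :=
  fun i => if i == k then t else x i.

Fixpoint iint (k : nat) (F : (nat -> R) -> \bar R) : (nat -> R) -> \bar R :=
  match k with
  | 0 => F
  | k'.+1 => fun x => (\int[@lebesgue_measure R]_t iint k' F (upd x k' t))%E
  end.

Definition vec_of d (x : nat -> R) : 'cV[R]_d := \col_(i < d) x i.

Definition lebesgue_vol d (S : set 'cV[R]_d) : \bar R :=
  iint d (fun x => (\1_S (vec_of d x))%:E) (fun _ => 0).

Definition SO d : set 'M[R]_d :=
  [set g | g *m g^T = 1%:M /\ \det g = 1].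

Definition MBorel d := g_sigma_algebraType (fun A : set 'M[R]_d => open A).

(** P is the Haar probability measure of SO(d): a Borel probability measure
    on matrices carried by SO(d) and invariant under left multiplication by
    elements of SO(d) (this characterises the Haar measure uniquely). *)
Definition haar_SO d (P : probability (MBorel d) R) : Prop :=
  P (@SO d : set (MBorel d)) = 1%E /\
  forall h : 'M[R]_d, @SO d h ->
    forall E : set (MBorel d), measurable E ->
      P ((fun g : MBorel d => (h *m g : MBorel d)) @^-1` E) = P E.

Definition rot_box d (g : 'M[R]_d) (a : 'I_d -> R) : set 'cV[R]_d :=
  (fun x => g *m x) @` box a.

Definition big_overlap_event d (c1 c2 : R) (a b : 'I_d -> R) : set (MBorel d) :=
  [set g | ((c1 * tvol a)%:E <= lebesgue_vol (rot_box g a `&` box b))%E /\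
           (lebesgue_vol (rot_box g a `&` box b) <= (c2 * tvol a)%:E)%E].

Definition Iab d (a b : 'I_d -> R) : R :=
  \prod_(i < d) \prod_(j < d) Num.min ((a i)^-1 * b j) 1.

End Defs.

(* Main.v *)
(* Write m_ji = min(b_j / a_i, 1), so that I(a, b) is the product of the m_ji.

   For g in SO(d), |g[a] ∩ [b]| ≳ |a| holds exactly when |g_ji| ≲ m_ji for all
   i, j.  Indeed these bounds put g[εa] inside [b]; conversely g[a] ∩ [b] lies in the
   parallelepiped obtained from g[a] by replacing its i-th slab by |y_j| <= b_j / 2,
   whose volume is comparable to |a| b_j / (a_i |g_ji|).

   It remains to see that the Haar measure of A = {g in SO(d) : |g_ji| <= k m_ji} is
   comparable to the product of the m_ji.  Put Lebesgue measure on all d x d matrices x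
   and compute by Tonelli the measure of the pairs (x, h) with x h in the box
   {|y_ji| <= r m_ji}.  For fixed h in SO(d) the x-measure is comparable to the product
   of the m_ji.  For fixed x = T q with T upper triangular and q in SO(d), the box
   condition on x h = T (q h) is equivalent, up to constants, to the one on q h, because
   m_ki <= m_ji for k >= j; by left invariance the h-measure is comparable to the Haar
   measure of A. *)
Require Import Defs.
From HB Require Import structures.
From mathcomp Require Import all_boot all_order all_algebra.
From mathcomp Require Import all_classical all_reals all_analysis.
From mathcomp Require Import Rstruct Rstruct_topology.
From mathcomp Require Import perm measurable_realfun ring lra.
Import Order.TTheory GRing.Theory Num.Theory.
Import numFieldNormedType.Exports.
Local Open Scope classical_set_scope.
Local Open Scope ring_scope.

(** * Iterated integrals *)

(** A nonnegative integral is a supremum over the simple functions below the integrand, so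
    monotonicity holds even for integrands not known to be measurable. Iterated integrals can then
    be compared one variable at a time. *)
Lemma integral_mono {dT : measure_display} {T : measurableType dT} {R : realType}
    (mu : {measure set T -> \bar R}) (f g : T -> \bar R) :
  (forall x, 0 <= f x)%E -> (forall x, f x <= g x)%E ->
  (\int[mu]_x f x <= \int[mu]_x g x)%E.
Proof.
move=> f0 fg.
have g0 x : (0 <= g x)%E by exact: le_trans (f0 x) (fg x).
rewrite !ge0_integralTE//; apply: le_ereal_sup => _ [h hf <-].
by exists h => // x; exact: le_trans (hf x) (fg x).
Qed.

Lemma iint_ge0 {R : realType} (k : nat) (F : (nat -> R) -> \bar R) :
  (forall x, 0 <= F x)%E -> forall x, (0 <= iint k F x)%E.
Proof. by move=> F0; elim: k => //= k IH x; apply: integral_ge0. Qed.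

Lemma eq_iint {R : realType} (k : nat) (F G : (nat -> R) -> \bar R) :
  F =1 G -> iint k F =1 iint k G.
Proof. by move=> /funext ->. Qed.

Definition seq_tail {R : realType} (x : nat -> R) : nat -> R := fun i => x i.+1.
Definition seq_cons {R : realType} (t : R) (x : nat -> R) : nat -> R :=
  fun i => if i is j.+1 then x j else t.

(* [iint] is defined by peeling the outermost integral; coordinate 0 is innermost. *)
Lemma iint_innermost {R : realType} (k : nat) (F : (nat -> R) -> \bar R) x :
  iint k.+1 F x =
  iint k (fun y => \int[@lebesgue_measure R]_t F (seq_cons t y))%E (seq_tail x).
Proof.
elim: k x => [|k IH] x.
  rewrite /=; congr integral; apply/funext => t; congr F.
  by apply/funext => -[|i].
rewrite [LHS]/= [RHS]/=; congr integral; apply/funext => t.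
have := IH (upd x k.+1 t); by rewrite /= => ->.
Qed.

Lemma integral_ball {R : realType} (c m s u : R) : 0 <= c -> m != 0 -> 0 <= s ->
  (\int[@lebesgue_measure R]_t (c * (`|m * t - u| <= s)%R%:R)%:E =
   (c * (2 * s / `|m|))%:E)%E.
Proof.
move=> c0 m0 s0; have m0' : 0 < `|m| by rewrite normr_gt0.
have mA : measurable [set` `[u / m - s / `|m|, u / m + s / `|m|]] by [].
transitivity (c%:E * (\int[@lebesgue_measure R]_t
    (\1_[set` `[u / m - s / `|m|, u / m + s / `|m|]] t)%:E))%E.
  rewrite -ge0_integralZl_EFin//; last first.
    exact/measurable_EFinP/measurable_indic.
  congr integral; apply/funext => t; rewrite EFinM indicE; congr (_ * ((nat_of_bool _)%:R)%:E)%E.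
  rewrite mem_setE in_itv/= -ler_distl -[RHS](ler_pM2l m0') -normrM mulrBr.
  by rewrite ![_ * (_ / _)]mulrC !divfK ?normr_eq0.
rewrite integral_indic//= setIT lebesgue_measure_itv/= lte_fin.
case: ltP => h; rewrite -?EFinD ?mule0.
  by rewrite -EFinM; congr EFin; ring.
(* The remaining case has endpoints equal or reversed, which forces [s = 0]; both sides then
   vanish. *)
have : s / `|m| <= 0 by lra.
rewrite pmulr_lle0 ?invr_gt0// => s0'.
have -> : s = 0 by apply/eqP; rewrite eq_le s0' s0.
by rewrite mulr0 mul0r mulr0.
Qed.

(** * Volumes of parallelepipeds *)

Definition in_slabs {R : realType} {k : nat} (M : 'M[R]_k) (v s : 'I_k -> R)
  (x : nat -> R) : bool :=
  [forall i, `|(M *m vec_of k x) i ord0 - v i| <= s i].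

Lemma mul_vec_ofE {R : realType} {m k : nat} (M : 'M[R]_(m, k)) (x : nat -> R) i :
  (M *m vec_of k x) i ord0 = \sum_(j < k) M i j * x j.
Proof. by rewrite mxE; apply: eq_bigr => j _; rewrite mxE. Qed.

Lemma mul_vec_of_cons {R : realType} {m k : nat} (M : 'M[R]_(m, k.+1)) (t : R)
    (y : nat -> R) i :
  (M *m vec_of k.+1 (seq_cons t y)) i ord0 =
  M i ord0 * t + \sum_(j < k) M i (lift ord0 j) * y j.
Proof. by rewrite mul_vec_ofE big_ord_recl. Qed.

(* A pivot in column 0, chosen so that eliminating with it enlarges no
   tolerance [s i] by more than a factor 2. *)
Lemma weighted_pivot {R : realType} {k : nat} (M : 'M[R]_k.+1) (s : 'I_k.+1 -> R) :
  (forall i, 0 < s i) -> \det M != 0 ->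
  exists2 p, M p ord0 != 0 & forall i, `|M i ord0| * s p <= `|M p ord0| * s i.
Proof.
move=> s0 dM.
case: (@arg_maxP _ R _ ord0 xpredT (fun i => `|M i ord0| / s i) isT) => p _ Hp.
have {}Hp i : `|M i ord0| * s p <= `|M p ord0| * s i.
  by have := Hp i isT; rewrite /= ler_pdivrMr ?s0// mulrAC ler_pdivlMr ?s0.
exists p => //; apply: contraNneq dM => Mp0.
rewrite (expand_det_col _ ord0) big1// => i _.
have := Hp i; rewrite Mp0 normr0 mul0r pmulr_lle0// normr_le0 => /eqP ->.
by rewrite mul0r.
Qed.

Definition schur {R : realType} {k : nat} (M : 'M[R]_k.+1) (p : 'I_k.+1) : 'M[R]_k :=
  \matrix_(i, j) (M (lift p i) (lift ord0 j)
    - M (lift p i) ord0 / M p ord0 * M p (lift ord0 j)).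

(** Column operations with the pivot clear the rest of row [p]; expanding along that row leaves the
    pivot times a minor, and this minor is the Schur complement. Absolute values absorb the cofactor
    sign. *)
Lemma det_schur {R : realType} {k : nat} (M : 'M[R]_k.+1) (p : 'I_k.+1) :
  M p ord0 != 0 -> `|\det M| = `|M p ord0| * `|\det (schur M p)|.
Proof.
move=> Mp0.
(* Right multiplication by [E] subtracts from each column [j] other than the first the multiple
   [M p j / M p ord0] of the first column. *)
pose E : 'M[R]_k.+1 := \matrix_(i, j)
  ((i == j)%:R - ((i == ord0) && (j != ord0))%:R * (M p j / M p ord0)).
have dE : \det E = 1.
  rewrite -det_tr det_trig.
    rewrite big1// => i _; rewrite !mxE eqxx.
    by case: (i == ord0); rewrite mul0r subr0.
  apply/is_trig_mxP => i j lij; rewrite !mxE.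
  have /negPf -> : j != ord0 by rewrite -lt0n; exact: leq_ltn_trans lij.
  by rewrite mul0r subr0 -val_eqE/= gtn_eqF.
have NE i j : (M *m E) i j = M i j - (j != ord0)%:R * (M i ord0 * (M p j / M p ord0)).
  rewrite mxE; under eq_bigr => l _ do rewrite mxE mulrBr.
  rewrite big_split/= (bigD1 j)//= eqxx mulr1 big1 ?addr0; last first.
    by move=> l /negPf ->; rewrite mulr0.
  congr (_ + _); rewrite (bigD1 ord0)//= big1 ?addr0.
    by case: (j != ord0); rewrite ?mul1r ?mul0r ?mulr0 ?oppr0.
  by move=> l /negPf -> /=; rewrite mul0r mulr0 oppr0.
have -> : \det M = \det (M *m E) by rewrite det_mulmx dE mulr1.
rewrite (expand_det_row _ p) big_ord_recl/= big1 ?addr0; last first.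
  move=> j _; by rewrite NE mul1r [_ * (_ / _)]mulrC divfK// subrr mul0r.
rewrite NE/= mul0r subr0 /cofactor normrM; congr (_ * _).
rewrite normrM normrX normrN1 expr1n mul1r; congr (`|\det _|).
by apply/matrixP => i j; rewrite 2![LHS]mxE NE mxE mul1r; congr (_ - _); ring.
Qed.

Definition schur_center {R : realType} {k : nat} (M : 'M[R]_k.+1) (p : 'I_k.+1)
  (v : 'I_k.+1 -> R) (i : 'I_k) : R :=
  v (lift p i) - M (lift p i) ord0 / M p ord0 * v p.

(** One elimination step on residuals: the first summand no longer involves [t], and the second is a
    slope times the residual of the pivot row, which [pivot_slope] keeps below the tolerance of the
    eliminated row. *)
Lemma mul_vec_of_schur {R : realType} {k : nat} (M : 'M[R]_k.+1) (p : 'I_k.+1)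
    (v : 'I_k.+1 -> R) (t : R) (y : nat -> R) i : M p ord0 != 0 ->
  (M *m vec_of k.+1 (seq_cons t y)) (lift p i) ord0 - v (lift p i) =
  ((schur M p *m vec_of k y) i ord0 - schur_center M p v i)
  + M (lift p i) ord0 / M p ord0 *
    ((M *m vec_of k.+1 (seq_cons t y)) p ord0 - v p).
Proof.
move=> Mp0; rewrite !mul_vec_of_cons mul_vec_ofE /schur_center.
under [X in _ = X - _ + _]eq_bigr => j _ do rewrite mxE mulrBl -[_ * _ * y j]mulrA.
rewrite big_split/= sumrN -mulr_sumr.
by field.
Qed.

Lemma pivot_slope {R : realType} (x y s t e : R) : y != 0 ->
  `|x| * s <= `|y| * t -> `|e| <= s -> `|x / y * e| <= t.
Proof.
move=> y0 xy es; rewrite normrM normrM normfV mulrAC ler_pdivrMr ?normr_gt0//.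
by rewrite [t * _]mulrC; apply: le_trans xy; rewrite ler_wpM2l.
Qed.

Lemma in_slabs_schur_upper {R : realType} {k : nat} (M : 'M[R]_k.+1)
    (v s : 'I_k.+1 -> R) (p : 'I_k.+1) (t : R) (y : nat -> R) :
  M p ord0 != 0 -> (forall i, `|M i ord0| * s p <= `|M p ord0| * s i) ->
  in_slabs M v s (seq_cons t y) ->
  in_slabs (schur M p) (schur_center M p v) (fun i => 2 * s (lift p i)) y.
Proof.
move=> Mp0 Hp /forallP Q; apply/forallP => i.
have := mul_vec_of_schur M p v t y i Mp0.
have := pivot_slope _ _ _ _ _ Mp0 (Hp (lift p i)) (Q p).
have := Q (lift p i); rewrite !ler_norml => /andP[? ?] /andP[? ?] ?.
by apply/andP; split; lra.
Qed.

Lemma in_slabs_schur_lower {R : realType} {k : nat} (M : 'M[R]_k.+1)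
    (v s : 'I_k.+1 -> R) (p : 'I_k.+1) (t : R) (y : nat -> R) :
  M p ord0 != 0 -> 0 <= s p ->
  (forall i, `|M i ord0| * s p <= `|M p ord0| * s i) ->
  in_slabs (schur M p) (schur_center M p v) (fun i => s (lift p i) / 2) y ->
  `|(M *m vec_of k.+1 (seq_cons t y)) p ord0 - v p| <= s p / 2 ->
  in_slabs M v s (seq_cons t y).
Proof.
move=> Mp0 sp0 Hp /forallP Q Qp; apply/forallP => i.
case: (unliftP p i) => [j ->|->]; last by apply: le_trans Qp _; lra.
rewrite (mul_vec_of_schur M p v t y j Mp0).
have Hj : `|M (lift p j) ord0| * (s p / 2) <= `|M p ord0| * (s (lift p j) / 2).
  by have := Hp (lift p j); rewrite !mulrA; lra.
have := pivot_slope _ _ _ _ _ Mp0 Hj Qp.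
have := Q j; rewrite !ler_norml => /andP[? ?] /andP[? ?].
by apply/andP; split; lra.
Qed.

Lemma prod_lift {R : realType} {k : nat} (p : 'I_k.+1) (f : 'I_k.+1 -> R) :
  \prod_i f i = f p * \prod_(i < k) f (lift p i).
Proof.
rewrite (bigD1 p)//=; congr (_ * _).
rewrite (reindex_omap (lift p) (unlift p))/=; last first.
  by move=> i; rewrite eq_sym => /unlift_some[j -> ->].
by apply: eq_bigl => i; rewrite liftK eqxx andbT eq_sym neq_lift.
Qed.

(** Induction that integrates out the innermost variable with the pivot row. The factor [c] and the
    mere domination of [F] make the statement stable: the inner integral is again dominated by a
    constant times a slab indicator, now for the Schur complement. *)
Lemma iint_slabs_upper {R : realType} (k : nat) : exists2 C : R, 0 < C &
  forall (M : 'M[R]_k) (v s : 'I_k -> R) (c : R) (F : (nat -> R) -> \bar R),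
  0 <= c -> (forall i, 0 < s i) -> \det M != 0 ->
  (forall x, 0 <= F x)%E ->
  (forall x, F x <= (c * (in_slabs M v s x)%:R)%:E)%E ->
  forall x, (iint k F x <= (c * (C * \prod_i s i / `|\det M|))%:E)%E.
Proof.
elim: k => [|k [C C0 IH]].
  exists 1 => // M v s c F c0 _ _ _ HF x /=; apply: le_trans (HF x) _.
  rewrite lee_fin det_mx00 big_ord0 normr1 !mulr1 divr1.
  by case: in_slabs; rewrite ?mulr1 ?mulr0.
(* One factor 2 is the length of the pivot interval over its radius; the other [k] come from
   doubling the remaining tolerances. *)
exists (2 ^+ k.+1 * C) => [|M v s c F c0 s0 dM F0 HF x].
  by rewrite mulr_gt0// exprn_gt0.
have [p Mp0 Hp] := weighted_pivot M s s0 dM.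
rewrite iint_innermost.
have dS := det_schur M p Mp0.
have dS0 : \det (schur M p) != 0.
  by move: dM; rewrite -normr_gt0 dS => h; apply: contraTneq h => ->; rewrite normr0 mulr0 ltxx.
have c0' : 0 <= c * (2 * s p / `|M p ord0|).
  by rewrite mulr_ge0// divr_ge0// mulr_ge0// ltW.
have s0' i : 0 < 2 * s (lift p i) by rewrite mulr_gt0.
apply: le_trans (IH (schur M p) (schur_center M p v) _ _ _ c0' s0' dS0 _ _ _) _.
- by move=> y; apply: integral_ge0.
- move=> y; set q := in_slabs _ _ _ y.
  (* With [y] fixed, the pivot slab becomes an interval in [t], centred at [u / M p ord0]. *)
  pose u := v p - \sum_(j < k) M p (lift ord0 j) * y j.
  have cq : 0 <= c * q%:R by rewrite mulr_ge0.
  rewrite -mulrA [_ * q%:R]mulrC mulrA -(@integral_ball _ _ _ _ u) ?(ltW (s0 p))//.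
  apply: integral_mono => // t; apply: le_trans (HF _) _.
  rewrite lee_fin -mulrA ler_wpM2l//.
  case: (boolP (in_slabs M v s (seq_cons t y))) => [Q|_]; last by rewrite mulr_ge0.
  have -> : q by exact: in_slabs_schur_upper Q.
  move/forallP: Q => /(_ p); rewrite mul_vec_of_cons /u opprB addrA => ->.
  by rewrite mulr1.
rewrite lee_fin dS (prod_lift p s) big_split/= prodr_const card_ord.
rewrite le_eqVlt; apply/orP; left; apply/eqP; rewrite exprS; field.
by rewrite !normr_eq0 dS0 Mp0.
Qed.

Lemma iint_slabs_lower {R : realType} (k : nat) : exists2 C : R, 0 < C &
  forall (M : 'M[R]_k) (v s : 'I_k -> R) (c : R) (F : (nat -> R) -> \bar R),
  0 <= c -> (forall i, 0 < s i) -> \det M != 0 ->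
  (forall x, (c * (in_slabs M v s x)%:R)%:E <= F x)%E ->
  forall x, ((c * (C * \prod_i s i / `|\det M|))%:E <= iint k F x)%E.
Proof.
elim: k => [|k [C C0 IH]].
  exists 1 => // M v s c F c0 _ _ HF x /=; apply: le_trans (HF x).
  rewrite lee_fin det_mx00 big_ord0 normr1 !mulr1 divr1.
  suff -> : in_slabs M v s x by rewrite mulr1.
  by apply/forallP => -[].
(* All tolerances are halved so that residual plus elimination error stays within the original slab.
   The pivot interval then has length [s p / |M p ord0|], and the other [k] halvings give the
   power. *)
exists ((2^-1) ^+ k * C) => [|M v s c F c0 s0 dM HF x].
  by rewrite mulr_gt0// exprn_gt0// invr_gt0.
have [p Mp0 Hp] := weighted_pivot M s s0 dM.
rewrite iint_innermost.
have dS := det_schur M p Mp0.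
have dS0 : \det (schur M p) != 0.
  by move: dM; rewrite -normr_gt0 dS => h; apply: contraTneq h => ->; rewrite normr0 mulr0 ltxx.
have c0' : 0 <= c * (2 * (s p / 2) / `|M p ord0|).
  by rewrite mulr_ge0// divr_ge0// mulr_ge0// divr_ge0// ltW.
have s0' i : 0 < s (lift p i) / 2 by rewrite divr_gt0.
apply: le_trans (IH (schur M p) (schur_center M p v) _ _ _ c0' s0' dS0 _ _).
  rewrite lee_fin dS (prod_lift p s) big_split/= prodr_const card_ord.
  rewrite le_eqVlt; apply/orP; left; apply/eqP; field.
  by rewrite !normr_eq0 dS0 Mp0.
move=> y; set q := in_slabs _ _ _ y.
pose u := v p - \sum_(j < k) M p (lift ord0 j) * y j.
have cq : 0 <= c * q%:R by rewrite mulr_ge0.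
have sp2 : 0 <= s p / 2 by rewrite divr_ge0// ltW.
have -> : c * (2 * (s p / 2) / `|M p ord0|) * q%:R =
    c * q%:R * (2 * (s p / 2) / `|M p ord0|) by ring.
rewrite -(@integral_ball _ _ _ _ u)//.
apply: integral_mono => t; first by rewrite lee_fin mulr_ge0.
apply: le_trans (HF _).
rewrite lee_fin -mulrA ler_wpM2l//.
case: (boolP q) => [Q|_]; last by rewrite mul0r.
rewrite mul1r; case: (boolP (`|_| <= _)) => // H.
suff -> : in_slabs M v s (seq_cons t y) by [].
apply: in_slabs_schur_lower Q _ => //; first exact: ltW.
by rewrite mul_vec_of_cons; move: H; rewrite /u opprB addrA.
Qed.

(** * Joint measurability and Tonelli's theorem *)

(* Measurability of [Phi : T -> (nat -> R) -> \bar R] in both arguments jointly,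
   tested along measurable maps so that no sigma-algebra on [nat -> R] is needed. *)
Definition jointly_measurable {R : realType} {dT : measure_display}
    {T : measurableType dT} (Phi : T -> (nat -> R) -> \bar R) : Prop :=
  forall (dU : measure_display) (U : measurableType dU) (u : U -> T)
    (x : U -> nat -> R),
  measurable_fun setT u -> (forall i, measurable_fun setT (fun w => x w i)) ->
  measurable_fun setT (fun w => Phi (u w) (x w)).

(** The induction hypothesis is tested on [U * R], whose second factor supplies the coordinate being
    integrated; Tonelli then gives measurability on [U]. Quantifying over all test spaces is what
    makes this enlargement possible. *)
Lemma jointly_measurable_iint {R : realType} {dT : measure_display}
    {T : measurableType dT} (Phi : T -> (nat -> R) -> \bar R) (k : nat) :
  (forall t x, 0 <= Phi t x)%E -> jointly_measurable Phi ->
  jointly_measurable (fun t => iint k (Phi t)).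
Proof.
move=> Phi0 mPhi; elim: k => [//|k IH] dU U u x mu mx /=.
pose f (w : U * R) := iint k (Phi (u w.1)) (upd (x w.1) k w.2).
have mf : measurable_fun setT f.
  apply: (IH _ (U * R)%type (u \o fst) (fun w => upd (x w.1) k w.2)).
    exact: measurableT_comp.
  move=> i; rewrite /upd; case: (i == k); first exact: measurable_snd.
  exact: (measurableT_comp (mx i) measurable_fst).
have f0 w : (0 <= f w)%E by exact: iint_ge0.
exact: (@measurable_fun_fubini_tonelli_F _ _ _ _ _ (@lebesgue_measure R) f mf f0).
Qed.

Lemma iint_integral_swap {R : realType} {dT : measure_display}
    {T : measurableType dT} (P : {sigma_finite_measure set T -> \bar R})
    (Phi : T -> (nat -> R) -> \bar R) (k : nat) :
  (forall t x, 0 <= Phi t x)%E -> jointly_measurable Phi ->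
  forall x, (iint k (fun y => \int[P]_t Phi t y) x = \int[P]_t iint k (Phi t) x)%E.
Proof.
move=> Phi0 mPhi; elim: k => [//|k IH] x /=.
under eq_integral do rewrite IH.
pose f (w : T * R) := iint k (Phi w.1) (upd x k w.2).
have mf : measurable_fun setT f.
  apply: (jointly_measurable_iint _ k Phi0 mPhi _ _ fst (fun w => upd x k w.2)) => //.
  move=> i; rewrite /upd; case: (i == k); first exact: measurable_snd.
  exact: measurable_cst.
have f0 w : (0 <= f w)%E by exact: iint_ge0.
exact: esym (@fubini_tonelli _ _ _ _ _ P (@lebesgue_measure R) f mf f0).
Qed.

(** * Measurability of finite conjunctions and of matrix expressions *)

Lemma measurable_forall {dT : measure_display} {T : measurableType dT}
    (I : finType) (B : I -> T -> bool) :
  (forall i, measurable_fun setT (B i)) ->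
  measurable_fun setT (fun w => [forall i, B i w]).
Proof.
move=> mB.
have -> : (fun w => [forall i, B i w]) = (fun w => all (B ^~ w) (enum I)).
  apply/funext => w; apply/forallP/allP => [H i _|H i]; first exact: H.
  by apply: H; rewrite mem_enum.
elim: (enum I) => [|i r IH] /=; first exact: measurable_cst.
exact: measurable_and.
Qed.

Lemma measurable_bigsum {R : realType} {dT : measure_display}
    {T : measurableType dT} (I : Type) (r : seq I) (p : pred I) (f : I -> T -> R) :
  (forall i, measurable_fun setT (f i)) ->
  measurable_fun setT (fun w => \sum_(i <- r | p i) f i w).
Proof.
move=> mf; elim: r => [|i r IH].
  by under eq_fun do rewrite big_nil; exact: measurable_cst.
under eq_fun do rewrite big_cons.
by case: (p i) => //; exact: measurable_funD.
Qed.

Lemma measurable_bigprod {R : realType} {dT : measure_display}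
    {T : measurableType dT} (I : Type) (r : seq I) (p : pred I) (f : I -> T -> R) :
  (forall i, measurable_fun setT (f i)) ->
  measurable_fun setT (fun w => \prod_(i <- r | p i) f i w).
Proof.
move=> mf; elim: r => [|i r IH].
  by under eq_fun do rewrite big_nil; exact: measurable_cst.
under eq_fun do rewrite big_cons.
by case: (p i) => //; exact: measurable_funM.
Qed.

Definition measurable_mx {R : realType} {dT : measure_display}
    {T : measurableType dT} {m n : nat} (A : T -> 'M[R]_(m, n)) : Prop :=
  forall i j, measurable_fun setT (fun w => A w i j).

Lemma measurable_mx_mul {R : realType} {dT : measure_display}
    {T : measurableType dT} {m n p : nat} (A : T -> 'M[R]_(m, n))
    (B : T -> 'M[R]_(n, p)) :
  measurable_mx A -> measurable_mx B -> measurable_mx (fun w => A w *m B w).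
Proof.
move=> mA mB i j; under eq_fun do rewrite mxE.
by apply: measurable_bigsum => k; exact: measurable_funM.
Qed.

Lemma measurable_det {R : realType} {dT : measure_display}
    {T : measurableType dT} {n : nat} (A : T -> 'M[R]_n) :
  measurable_mx A -> measurable_fun setT (fun w => \det (A w)).
Proof.
move=> mA; apply: measurable_bigsum => s; apply: measurable_funM => //.
exact: measurable_bigprod.
Qed.

Lemma measurable_adj {R : realType} {dT : measure_display}
    {T : measurableType dT} {n : nat} (A : T -> 'M[R]_n) :
  measurable_mx A -> measurable_mx (fun w => \adj (A w)).
Proof.
move=> mA i j; under eq_fun do rewrite mxE.
apply: measurable_funM => //; apply: measurable_det => k l.
by under eq_fun do rewrite !mxE; exact: mA.
Qed.

Lemma measurable_coord {R : realType} (d : nat) :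
  measurable_mx (fun g : MBorel R d => (g : 'M[R]_d)).
Proof.
move=> i j; apply: (measurability _ (RGenOpens.measurableE R)) => //.
move=> _ [_ [a [b ->]] <-]; rewrite setTI; apply: sub_sigma_algebra.
have := @coord_continuous R d d i j; rewrite continuousP; apply.
exact: interval_open.
Qed.

Lemma measurable_mx_comp {R : realType} {dT dU : measure_display}
    {T : measurableType dT} {U : measurableType dU} {m n : nat}
    (A : T -> 'M[R]_(m, n)) (u : U -> T) :
  measurable_fun setT u -> measurable_mx A -> measurable_mx (A \o u).
Proof. by move=> mu mA i j; exact: (measurableT_comp (mA i j)). Qed.

Lemma measurable_vec_of {R : realType} {dT : measure_display}
    {T : measurableType dT} (k : nat) (x : T -> nat -> R) :
  (forall i, measurable_fun setT (fun w => x w i)) ->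
  measurable_mx (fun w => vec_of k (x w)).
Proof. by move=> mx i j; under eq_fun do rewrite mxE; exact: mx. Qed.

Lemma measurable_mx_cst {R : realType} {dT : measure_display}
    {T : measurableType dT} {m n : nat} (A : 'M[R]_(m, n)) :
  measurable_mx (fun _ : T => A).
Proof. by move=> i j; exact: measurable_cst. Qed.

Lemma measurable_norm_le {R : realType} {dT : measure_display}
    {T : measurableType dT} (f g : T -> R) :
  measurable_fun setT f -> measurable_fun setT g ->
  measurable_fun setT (fun w => `|f w| <= g w).
Proof.
by move=> mf mg; apply: measurable_fun_ler => //; exact: measurableT_comp.
Qed.

Lemma measurable_indicb {R : realType} {dT : measure_display}
    {T : measurableType dT} (b : T -> bool) :
  measurable_fun setT b -> measurable_fun setT (fun w => ((b w)%:R : R)%:E).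
Proof.
move=> mb; apply/measurable_EFinP.
have -> : (fun w => (b w)%:R : R) = (fun w => if b w then 1 else 0).
  by apply/funext => w; case: (b w).
by apply: measurable_fun_ifT.
Qed.

(** * Orthogonal and triangular matrices *)

Lemma sum_dot {R : realType} {n : nat} (A B : 'M[R]_n) (i j : 'I_n) :
  (A *m B^T) i j = \sum_k A i k * B j k.
Proof. by rewrite mxE; apply: eq_bigr => k _; rewrite mxE. Qed.

Lemma orthogonal_entry_le1 {R : realType} {n : nat} (q : 'M[R]_n) i j :
  q *m q^T = 1%:M -> `|q i j| <= 1.
Proof.
move=> /matrixP/(_ i i); rewrite sum_dot mxE eqxx mulr1n (bigD1 j)//= => H.
rewrite -(@ler_pXn2r _ 2)// ?nnegrE// expr1n real_normK ?num_real// expr2 -H.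
by rewrite lerDl sumr_ge0// => k _; rewrite -expr2 sqr_ge0.
Qed.

Lemma SO_trmul {R : realType} {n : nat} (g : 'M[R]_n) : SO g -> g^T *m g = 1%:M.
Proof. by case=> /mulmx1C. Qed.

Lemma SO_mul {R : realType} {n : nat} (g h : 'M[R]_n) : SO g -> SO h -> SO (g *m h).
Proof.
move=> [g1 dg] [h1 dh]; split; last by rewrite det_mulmx dg dh mulr1.
by rewrite trmx_mul mulmxA -(mulmxA g) h1 mulmx1.
Qed.

Lemma SO_tr {R : realType} {n : nat} (g : 'M[R]_n) : SO g -> SO g^T.
Proof. by move=> /[dup] /SO_trmul g1 [_ dg]; split; rewrite ?trmxK ?det_tr. Qed.

Lemma mulmx_entry_le {R : realType} {m n p : nat} (A : 'M[R]_(m, n))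
    (B : 'M[R]_(n, p)) (i : 'I_m) (j : 'I_p) (c e : R) :
  (forall k, `|A i k| * `|B k j| <= c * e) -> `|(A *m B) i j| <= n%:R * c * e.
Proof.
move=> H; rewrite mxE; apply: le_trans (ler_norm_sum _ _ _) _.
rewrite -mulrA mulr_natl -[X in _ *+ X]card_ord -sumr_const ler_sum// => k _.
by rewrite normrM.
Qed.

(* [Q] is the Householder reflection exchanging [r] and [rho *: delta_mx 0 ord0]. *)
Lemma reflect_to_axis {R : realType} {n : nat} (r : 'rV[R]_n.+1) :
  exists (Q : 'M[R]_n.+1) (rho : R),
    Q *m Q^T = 1%:M /\ r *m Q = rho *: delta_mx 0 ord0.
Proof.
pose dot (u v : 'rV[R]_n.+1) := (u *m v^T) 0 0.
have dotC u v : dot u v = dot v u by rewrite /dot -[u in LHS]trmxK -trmx_mul mxE.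
have dotB u v w : dot (u - v) w = dot u w - dot v w.
  by rewrite /dot mulmxBl !mxE.
have dot_ge0 u : 0 <= dot u u.
  by rewrite /dot mxE sumr_ge0// => i _; rewrite mxE -expr2 sqr_ge0.
have dot0 u : dot u u = 0 -> u = 0.
  rewrite /dot mxE => H; apply/rowP => i; rewrite mxE.
  have := psumr_eq0P _ H => /(_ _ i isT); rewrite mxE => /(_ _)/eqP.
  rewrite mulf_eq0 orbb => /(_ _)/eqP; apply => k _.
  by rewrite mxE -expr2 sqr_ge0.
pose rho := Num.sqrt (dot r r); pose e : 'rV[R]_n.+1 := rho *: delta_mx 0 ord0.
have dote : dot e e = dot r r.
  rewrite -[RHS]sqr_sqrtr// -/rho /dot /e linearZ/= -scalemxAl -scalemxAr trmx_delta mul_delta_mx.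
  by rewrite !mxE !eqxx mulr1 -expr2.
have [w wE] : {w | w = r - e} by exists (r - e).
have [w0|w0] := eqVneq w 0.
  exists 1%:M, rho; rewrite trmx1 !mulmx1; split=> //.
  by apply/eqP; rewrite -subr_eq0 -/e -wE w0.
have dw : dot w w != 0 by apply: contraNneq w0 => /dot0 ->.
pose a := 2 / dot w w.
pose Q : 'M[R]_n.+1 := 1%:M - a *: (w^T *m w).
have QT : Q^T = Q by rewrite /Q linearB/= linearZ/= trmx1 trmx_mul trmxK.
have ww : w *m w^T = (dot w w)%:M by rewrite [LHS]mx11_scalar.
exists Q, rho; split.
  rewrite QT /Q mulmxBl mul1mx mulmxBr mulmx1 -scalemxAl -scalemxAr scalerA.
  rewrite mulmxA -(mulmxA w^T) ww mul_mx_scalar -scalemxAl scalerA.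
  rewrite /a; have -> : 2 / dot w w * (2 / dot w w) * dot w w = 2 / dot w w + 2 / dot w w.
    by field.
  by rewrite scalerDl opprB addrK subrK.
rewrite /Q mulmxBr mulmx1 -scalemxAr mulmxA [r *m w^T]mx11_scalar mul_scalar_mx.
rewrite scalerA -/(dot r w).
(* Since [r] and [e] have the same length, [dot w w = 2 * dot r w]; hence the reflection subtracts
   exactly [w] from [r] and lands on [e]. *)
have -> : a * dot r w = 1.
  have -> : dot r w = dot w w / 2.
    have dww : dot w w = 2 * dot r w.
      by rewrite wE dotB ![dot _ (r - e)]dotC !dotB dote [dot e r]dotC; ring.
    by rewrite dww mulrC mulKf.
  by rewrite /a; field.
by rewrite scale1r wE opprB addrC subrK.
Qed.

(** Reflecting the first row onto the first axis makes the matrix block lower triangular, and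
    induction treats the lower right block. The inverse [S] is built alongside [T] by the block
    formula, so that its triangularity is at hand. *)
Lemma LQ_decomposition {R : realType} (n : nat) (x : 'M[R]_n) : \det x != 0 ->
  exists T S q : 'M[R]_n, [/\ is_trig_mx T, is_trig_mx S, S *m T = 1%:M,
    q *m q^T = 1%:M & x = T *m q].
Proof.
elim: n x => [|n IH].
  move=> x _; exists 1%:M, 1%:M, 1%:M; rewrite trmx1 mulmx1; split=> //.
  by rewrite [LHS]flatmx0 [RHS]flatmx0.
change (forall x : 'M[R]_(1 + n), \det x != 0 ->
  exists T S q : 'M[R]_(1 + n), [/\ is_trig_mx T, is_trig_mx S, S *m T = 1%:M,
    q *m q^T = 1%:M & x = T *m q]) => x dx.
have [Q [rho [Q1 rQ]]] : exists (Q : 'M[R]_(1 + n)) (rho : R),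
    Q *m Q^T = 1%:M /\ row ord0 x *m Q = rho *: delta_mx 0 ord0.
  exact: reflect_to_axis.
have [y yxQ] : {y : 'M[R]_(1 + n) | y = x *m Q} by exists (x *m Q).
have y0 j : y ord0 j = rho * (j == ord0)%:R.
  have /rowP/(_ j) := rQ; rewrite -row_mul mxE => rQj.
  by rewrite yxQ; apply: etrans rQj _; rewrite !mxE eqxx.
have yE : y = block_mx rho%:M 0 (dlsubmx y) (drsubmx y).
  have l0 : lshift n (0 : 'I_1) = ord0 by apply: val_inj.
  rewrite -[LHS]submxK; congr block_mx; apply/matrixP => i j; rewrite !mxE !ord1 l0 y0.
    by rewrite mulr1.
  by rewrite -val_eqE/= mulr0.
have dQ : \det Q != 0.
  apply: contra_eqN Q1 => /eqP dQ; apply/eqP => /(congr1 determinant).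
  by rewrite det_mulmx dQ mul0r det1 => /eqP; rewrite eq_sym oner_eq0.
have : \det y != 0 by rewrite yxQ det_mulmx mulf_neq0.
rewrite yE det_lblock det_scalar1 mulf_eq0.
rewrite negb_or => /andP[rho0 /IH[T [S [q [hT hS ST qq yq]]]]].
exists (block_mx rho%:M 0 (dlsubmx y) T).
exists (block_mx rho^-1%:M 0 (- (rho^-1 *: (S *m dlsubmx y))) S).
exists (block_mx 1%:M 0 0 q *m Q^T).
have trig1 (c : R) : is_trig_mx (c%:M : 'M[R]_1).
  by apply/is_trig_mxP => i j; rewrite !ord1.
split.
- by rewrite is_trig_block_mx// eqxx hT trig1.
- by rewrite is_trig_block_mx// eqxx hS trig1.
- rewrite mulmx_block !mulmx0 !mul0mx !addr0 add0r ST -scalar_mxM mulVf//.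
  rewrite mul_mx_scalar scalerN scalerA mulfV// scale1r addNr.
  by rewrite -scalar_mx_block.
- rewrite trmx_mul trmxK mulmxA -(mulmxA _ Q^T) (mulmx1C Q1) mulmx1.
  by rewrite tr_block_mx mulmx_block !trmx0 trmx1 !mulmx0 !mul0mx !addr0 add0r
     mulmx1 qq -scalar_mx_block.
- rewrite mulmxA mulmx_block !mulmx0 !mul0mx !mulmx1 !addr0 add0r -yq -yE.
  by rewrite yxQ -mulmxA Q1 mulmx1.
Qed.

Definition upper_trig {R : realType} {n : nat} (T : 'M[R]_n) : Prop :=
  forall i j : 'I_n, (j < i)%N -> T i j = 0.

(** Apply the lower triangular version to the row-reversed matrix: conjugation by the reversal [J]
    turns lower triangular into upper triangular. A diagonal sign matrix [D], slipped between the
    factors, puts the orthogonal one in SO. *)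
Lemma RQ_decomposition {R : realType} (n : nat) (x : 'M[R]_n.+1) : \det x != 0 ->
  exists T S q : 'M[R]_n.+1, [/\ upper_trig T, upper_trig S, S *m T = 1%:M,
    SO q & x = T *m q].
Proof.
move=> dx.
pose J : 'M[R]_n.+1 := \matrix_(i, j) (i == rev_ord j)%:R.
have JM A i j : (J *m A) i j = A (rev_ord i) j.
  rewrite mxE (bigD1 (rev_ord i))//= !mxE rev_ordK eqxx mul1r big1 ?addr0// => k.
  rewrite mxE => ki; case: eqP => [ik|]; last by rewrite mul0r.
  by move: ki; rewrite ik rev_ordK eqxx.
have MJ A i j : (A *m J) i j = A i (rev_ord j).
  rewrite mxE (bigD1 (rev_ord j))//= !mxE eqxx mulr1 big1 ?addr0// => k.
  by rewrite mxE => /negPf ->; rewrite mulr0.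
have JJ : J *m J = 1%:M.
  by apply/matrixP => i j; rewrite JM !mxE (inj_eq rev_ord_inj).
have JT : J^T = J.
  by apply/matrixP => i j; rewrite !mxE -(inj_eq rev_ord_inj) rev_ordK eq_sym.
have dJx : \det (J *m x) != 0.
  rewrite det_mulmx mulf_neq0//; apply/eqP => dJ.
  move: JJ => /(congr1 determinant)/eqP.
  by rewrite det_mulmx dJ mul0r det1 eq_sym oner_eq0.
have [L [K [q [/is_trig_mxP hL /is_trig_mxP hK KL qq Jx]]]] := LQ_decomposition _ _ dJx.
(* The determinant of [J *m q] is a sign, because its square is 1; placing it in one diagonal entry
   of [D] makes [D *m (J *m q)] have determinant 1. *)
pose e : 'rV[R]_n.+1 := \row_j (if j == ord0 then \det (J *m q) else 1).
pose D := diag_mx e.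
have dq2 : \det (J *m q) * \det (J *m q) = 1.
  rewrite -{2}det_tr -det_mulmx trmx_mul mulmxA -(mulmxA J) qq mulmx1 JT JJ.
  by rewrite det1.
have DD : D *m D = 1%:M.
  rewrite /D mulmx_diag -diag_const_mx; congr diag_mx; apply/rowP => j.
  by rewrite !mxE; case: ifP => _; rewrite ?mulr1.
have DT : D^T = D by rewrite tr_diag_mx.
have dD : \det D = \det (J *m q).
  rewrite det_diag (bigD1 ord0)//= mxE eqxx big1 ?mulr1// => j /negPf j0.
  by rewrite mxE j0.
have trig (A : 'M[R]_n.+1) : (forall i j : 'I_n.+1, (i < j)%N -> A i j = 0) ->
    upper_trig (J *m A *m J).
  move=> hA i j ji; rewrite MJ JM hA//= ltn_sub2l// ltnS.
  exact: leq_trans ji (ltn_ord i).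
have trigD (A : 'M[R]_n.+1) : upper_trig A -> upper_trig (A *m D) /\ upper_trig (D *m A).
  by move=> hA; split=> i j ji; rewrite ?mul_mx_diag ?mul_diag_mx mxE hA// ?mul0r ?mulr0.
exists (J *m L *m J *m D), (D *m (J *m K *m J)), (D *m (J *m q)); split.
- by case: (trigD _ (trig _ hL)).
- by case: (trigD _ (trig _ hK)).
- rewrite !mulmxA -(mulmxA _ J J) JJ mulmx1 -(mulmxA _ K) KL mulmx1.
  by rewrite -(mulmxA D) JJ mulmx1 DD.
- split; last by rewrite det_mulmx dD dq2.
  rewrite !trmx_mul JT DT !mulmxA -(mulmxA _ q) qq mulmx1 -(mulmxA D) JJ mulmx1.
  exact: DD.
- rewrite !mulmxA -(mulmxA _ D D) DD mulmx1 -(mulmxA _ J J) JJ mulmx1.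
  by rewrite -(mulmxA J) -Jx mulmxA JJ mul1mx.
Qed.

(** Write [S = S y - S (y - 1)] and look at the largest entry of a row of [S]: the second term is at
    most half of that entry and can be absorbed. *)
Lemma near_id_bound {R : realType} {m n : nat} (S : 'M[R]_(m, n.+1)) (y : 'M[R]_n.+1)
    (B : R) :
  (forall i j, `|y i j - (i == j)%:R| <= (2 * n.+1%:R)^-1) ->
  (forall i j, `|(S *m y) i j| <= B) -> forall i j, `|S i j| <= 2 * B.
Proof.
move=> hy hS i j.
case: (@arg_maxP _ R _ ord0 xpredT (fun j => `|S i j|) isT) => p _ Hp.
suff : `|S i p| <= 2 * B by apply: le_trans; exact: Hp.
have N0 : 0 < n.+1%:R :> R by rewrite ltr0n.
have E : S i p = (S *m y) i p - (S *m (y - 1%:M)) i p.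
  by rewrite mulmxBr mulmx1 !mxE; ring.
have : `|(S *m (y - 1%:M)) i p| <= n.+1%:R * `|S i p| * (2 * n.+1%:R)^-1.
  apply: mulmx_entry_le => k; rewrite ler_pM//; first exact: Hp.
  by rewrite !mxE; exact: hy.
have -> : n.+1%:R * `|S i p| * (2 * n.+1%:R)^-1 = `|S i p| / 2.
  by field; rewrite gt_eqF.
have := hS i p; have := ler_normB ((S *m y) i p) ((S *m (y - 1%:M)) i p).
by rewrite -E; lra.
Qed.

Lemma near_id_det {R : realType} {n : nat} (y : 'M[R]_n.+1) :
  (forall i j, `|y i j - (i == j)%:R| <= (2 * n.+1%:R)^-1) -> \det y != 0.
Proof.
move=> hy; apply/negP => /det0P[v v0 vy]; move/eqP: v0; apply.
apply/rowP => j; have := near_id_bound v y 0 hy _ 0 j.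
rewrite mulr0 normr_le0 mxE => H; apply/eqP/H => k l.
by rewrite vy mxE normr0.
Qed.

Lemma det_id_row {R : realType} {n : nat} (i : 'I_n) (w : 'I_n -> R) :
  \det (\matrix_(k, l) if k == i then w l else (k == l)%:R) = w i.
Proof.
set N := \matrix_(_, _) _.
rewrite (expand_det_col _ i) (bigD1 i)//= big1 ?addr0; last first.
  by move=> k /negPf ki; rewrite mxE ki mul0r.
rewrite mxE eqxx /cofactor -signr_odd addnn odd_double expr0 mul1r.
suff -> : row' i (col' i N) = 1%:M by rewrite det1 mulr1.
apply/matrixP => k l; rewrite !mxE eq_sym (negPf (neq_lift _ _)).
by rewrite (inj_eq lift_inj).
Qed.

(** * The determinant of right multiplication on the space of matrices *)

Lemma det_le_fact {R : realType} {n : nat} (A : 'M[R]_n) :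
  (forall i j, `|A i j| <= 1) -> `|\det A| <= n`!%:R.
Proof.
move=> hA; apply: le_trans (ler_norm_sum _ _ _) _.
rewrite -card_Sn -sum1_card natr_sum ler_sum// => s _.
rewrite normrM normrX normrN1 expr1n mul1r normr_prod.
by apply: prodr_ile1 => i _; rewrite normr_ge0 hA.
Qed.

Lemma lin_mulmxr_entry {R : realType} {m n p : nat} (h : 'M[R]_(n, p))
    (i : 'I_m) (j : 'I_n) (k : 'I_m) (l : 'I_p) :
  lin_mulmxr h (mxvec_index i j) (mxvec_index k l) = (i == k)%:R * h j l.
Proof.
have := mul_vec_lin (@mulmxr R m n p h) (delta_mx i j).
rewrite mxvec_delta -rowE => /rowP/(_ (mxvec_index k l)).
rewrite mxE mxvecE /= => ->; rewrite mxE (bigD1 j)//= !mxE eqxx andbT [k == i]eq_sym.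
by rewrite big1 ?addr0// => a /negPf aj; rewrite mxE aj andbF mul0r.
Qed.

(** Entries of orthogonal matrices are at most 1, so the Leibniz expansion bounds the determinant
    above. The inverse map is right multiplication by [h^T], to which the same bound applies, and
    this gives the lower bound. *)
Lemma SO_lin_mulmxr_det {R : realType} {n : nat} (h : 'M[R]_n) : SO h ->
  ((n * n)`!%:R : R)^-1 <= `|\det (lin_mulmxr h : 'M[R]_(n * n))| <= (n * n)`!%:R.
Proof.
have bound (g : 'M[R]_n) : SO g -> `|\det (lin_mulmxr g : 'M[R]_(n * n))| <= (n * n)`!%:R.
  move=> [g1 _]; apply: det_le_fact => p q.
  case/mxvec_indexP: p => i j; case/mxvec_indexP: q => k l.
  rewrite lin_mulmxr_entry; case: (i == k); rewrite ?mul0r ?normr0// mul1r.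
  exact: orthogonal_entry_le1.
move=> h1; rewrite bound// andbT.
have E : (lin_mulmxr h : 'M[R]_(n * n)) *m lin_mulmxr h^T = 1%:M.
  apply/row_matrixP => p; rewrite row_mul !rowE mulmx1.
  rewrite -[delta_mx 0 p]vec_mxK mul_vec_lin/= mul_vec_lin/=.
  by rewrite -mulmxA (proj1 h1) mulmx1.
have N0 : 0 < (n * n)`!%:R :> R by rewrite ltr0n fact_gt0.
rewrite -div1r ler_pdivrMr//.
have E1 : `|\det (lin_mulmxr h : 'M[R]_(n * n))| *
          `|\det (lin_mulmxr h^T : 'M[R]_(n * n))| = 1.
  by rewrite -normrM -det_mulmx E det1 normr1.
rewrite -[X in X <= _]E1; apply: ler_wpM2l => //.
by apply: bound; exact: SO_tr.
Qed.

(** Identifies the first [m * n] coordinates with matrix entries, so that [iint (m * n)] integrates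
    over Lebesgue measure on matrices. *)
Definition mx_of {R : realType} (m n : nat) (x : nat -> R) : 'M[R]_(m, n) :=
  vec_mx (vec_of (m * n) x)^T.

Lemma in_slabs_mx {R : realType} {n : nat} (h V B : 'M[R]_n) (x : nat -> R) :
  in_slabs (lin_mulmxr h : 'M[R]_(n * n))^T (mxvec V 0) (mxvec B 0) x =
  [forall i, forall j, `|(mx_of n n x *m h) i j - V i j| <= B i j].
Proof.
have E p : ((lin_mulmxr h : 'M[R]_(n * n))^T *m vec_of (n * n) x) p 0 =
    mxvec (mx_of n n x *m h) 0 p.
  have := mul_vec_lin (@mulmxr R n n n h) (mx_of n n x).
  rewrite /= vec_mxK => <-.
  transitivity (((vec_of (n * n) x)^T *m lin_mulmxr h)^T p 0); last by rewrite mxE.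
  by rewrite trmx_mul trmxK.
apply/forallP/'forall_forallP => [H i j|H p].
  by have := H (mxvec_index i j); rewrite E !mxvecE.
by case/mxvec_indexP: p => i j; rewrite E !mxvecE.
Qed.

Lemma prod_mxvec {R : realType} {m n : nat} (B : 'M[R]_(m, n)) :
  \prod_p mxvec B 0 p = \prod_i \prod_j B i j.
Proof.
rewrite pair_bigA/= (reindex _ (curry_mxvec_bij _ _))/=.
by apply: eq_bigr => -[i j] _; rewrite /= mxvecE.
Qed.

(** * The volume of the overlap *)

Lemma lebesgue_vol_slabs_upper {R : realType} (d : nat) : exists2 C : R, 0 < C &
  forall (M : 'M[R]_d) (s : 'I_d -> R) (S : set 'cV[R]_d),
  (forall i, 0 < s i) -> \det M != 0 ->
  (forall y, S y -> forall i, `|(M *m y) i ord0| <= s i) ->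
  (lebesgue_vol S <= (C * \prod_i s i / `|\det M|)%:E)%E.
Proof.
have [C C0 HC] := @iint_slabs_upper R d; exists C => // M s S s0 dM HS.
have := HC M (fun=> 0) s 1 (fun x => (\1_S (vec_of d x))%:E) ler01 s0 dM.
rewrite mul1r; apply=> x; first by rewrite lee_fin indicE.
rewrite lee_fin mul1r indicE; case: (boolP (_ \in S)) => // /set_mem Sx.
suff -> : in_slabs M (fun=> 0) s x by [].
by apply/forallP => i; rewrite subr0; exact: HS.
Qed.

Lemma lebesgue_vol_slabs_lower {R : realType} (d : nat) : exists2 C : R, 0 < C &
  forall (M : 'M[R]_d) (s : 'I_d -> R) (S : set 'cV[R]_d),
  (forall i, 0 < s i) -> \det M != 0 ->
  (forall y, (forall i, `|(M *m y) i ord0| <= s i) -> S y) ->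
  ((C * \prod_i s i / `|\det M|)%:E <= lebesgue_vol S)%E.
Proof.
have [C C0 HC] := @iint_slabs_lower R d; exists C => // M s S s0 dM HS.
have := HC M (fun=> 0) s 1 (fun x => (\1_S (vec_of d x))%:E) ler01 s0 dM.
rewrite mul1r; apply=> x.
rewrite lee_fin mul1r indicE; case: (boolP (in_slabs _ _ _ _)) => // /forallP H.
rewrite mem_set//; apply: HS => i.
by have := H i; rewrite subr0.
Qed.

Lemma in_boxE {R : realType} {d : nat} (s : 'I_d -> R) (y : 'cV[R]_d) :
  box s y <-> forall i, `|y i ord0| <= s i / 2.
Proof. by split=> H i; have := H i; rewrite ler_norml. Qed.

Lemma rot_boxE {R : realType} {d : nat} (g : 'M[R]_d) (s : 'I_d -> R) (y : 'cV[R]_d) :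
  SO g -> rot_box g s y <-> forall i, `|(g^T *m y) i ord0| <= s i / 2.
Proof.
move=> gS; split=> [[x /in_boxE sx <-]|H].
  by rewrite mulmxA SO_trmul// mul1mx.
exists (g^T *m y); first exact/in_boxE.
by rewrite mulmxA (proj1 gS) mul1mx.
Qed.

Lemma overlap_upper {R : realType} (d : nat) : exists2 C : R, 0 < C &
  forall (a b : 'I_d -> R) (g : 'M[R]_d),
  (forall i, 0 < a i) -> (forall i, 0 < b i) -> SO g ->
  (lebesgue_vol (rot_box g a `&` box b) <= (C * tvol a)%:E)%E /\
  forall (c : R), 0 < c ->
    ((c * tvol a)%:E <= lebesgue_vol (rot_box g a `&` box b))%E ->
    forall i j, `|g j i| <= C / c * ((a i)^-1 * b j).
Proof.
have [C C0 HC] := @lebesgue_vol_slabs_upper R d; exists C => // a b g a0 b0 gS.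
have half s : 0 < s -> s / 2 <= s :> R by move=> ?; lra.
split.
  have := HC g^T a (rot_box g a `&` box b) a0.
  rewrite det_tr (proj2 gS) normr1 divr1; apply; first exact: oner_neq0.
  move=> y [/(rot_boxE _ _ _ gS) H _] i; exact: le_trans (H i) (half _ _).
move=> c c0 Hc i j.
have [->|gji] := eqVneq (g j i) 0.
  by rewrite normr0 !mulr_ge0 ?invr_ge0 ?ltW.
(* Replacing row [i] of [g^T] by [e_j] gives determinant [g j i]. *)
pose M : 'M[R]_d := \matrix_(k, l) if k == i then (l == j)%:R else g l k.
have MgE : M *m g = \matrix_(k, l) if k == i then g j l else (k == l)%:R.
  apply/matrixP => k l; rewrite [RHS]mxE; case: ifPn => ki.
    rewrite mxE (bigD1 j)//= mxE ki eqxx mul1r big1 ?addr0// => p /negPf pj.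
    by rewrite mxE ki pj mul0r.
  have /matrixP/(_ k l) := SO_trmul _ gS; rewrite !mxE => <-.
  by apply: eq_bigr => p _; rewrite !mxE (negPf ki).
have dM : \det M = g j i.
  by rewrite -[LHS]mulr1 -(proj2 gS) -det_mulmx MgE det_id_row.
pose s k := if k == i then b j else a k.
have s0 k : 0 < s k by rewrite /s; case: ifP.
have sub y : (rot_box g a `&` box b) y -> forall k, `|(M *m y) k ord0| <= s k.
  move=> [/(rot_boxE _ _ _ gS) Ha /in_boxE Hb] k; rewrite /s; case: ifPn => ki.
    suff -> : (M *m y) k ord0 = y j ord0 by exact: le_trans (Hb j) (half _ _).
    rewrite mxE (bigD1 j)//= mxE ki eqxx mul1r big1 ?addr0// => p /negPf pj.
    by rewrite mxE ki pj mul0r.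
  suff -> : (M *m y) k ord0 = (g^T *m y) k ord0 by exact: le_trans (Ha k) (half _ _).
  by rewrite !mxE; apply: eq_bigr => p _; rewrite !mxE (negPf ki).
have gM : \det M != 0 by rewrite dM.
(* Cancelling the common product of the other [a k] from the two volume bounds leaves
   [c * a i * |g j i| <= C * b j]. *)
have := le_trans Hc (HC M s _ s0 gM sub).
rewrite lee_fin dM /tvol (bigD1 i)//= [X in _ <= _ * X / _](bigD1 i)//= {1}/s eqxx.
have -> : \prod_(k < d | k != i) s k = \prod_(k < d | k != i) a k.
  by apply: eq_bigr => k /negPf ki; rewrite /s ki.
have : 0 < \prod_(k < d | k != i) a k by rewrite prodr_gt0.
move: (\prod_(_ < d | _) _) => A A0.
have g0 : 0 < `|g j i| by rewrite normr_gt0.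
rewrite ler_pdivlMr// => H.
have -> : C / c * ((a i)^-1 * b j) = C * b j / (c * a i).
  by field; rewrite !gt_eqF.
rewrite ler_pdivlMr ?mulr_gt0// -(ler_pM2r A0).
by apply: le_trans (le_trans _ H) _; rewrite le_eqVlt; apply/orP; left; apply/eqP; ring.
Qed.

Lemma overlap_lower {R : realType} (d : nat) (kappa : R) : 0 < kappa ->
  exists2 c : R, 0 < c &
  forall (a b : 'I_d -> R) (g : 'M[R]_d),
  (forall i, 0 < a i) -> (forall i, 0 < b i) -> SO g ->
  (forall i j, `|g j i| <= kappa * ((a i)^-1 * b j)) ->
  ((c * tvol a)%:E <= lebesgue_vol (rot_box g a `&` box b))%E.
Proof.
move=> k0; have [C C0 HC] := @lebesgue_vol_slabs_lower R d.
(* Chosen so that [eps <= 1] and [d * kappa * eps <= 1]: the shrunken box [g[eps a]] then lies in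
   [g[a]] and, by the entry bounds, in [[b]]. *)
pose eps := (1 + d%:R * kappa)^-1.
have dk : 0 <= d%:R * kappa by rewrite mulr_ge0// ltW.
have eps0 : 0 < eps by rewrite /eps invr_gt0; lra.
have eps1 : eps <= 1 by rewrite /eps invf_le1; lra.
have epsk : d%:R * kappa * eps <= 1 by rewrite /eps ler_pdivrMr; lra.
exists (C * (eps / 2) ^+ d) => [|a b g a0 b0 gS Hg].
  by rewrite mulr_gt0// exprn_gt0// divr_gt0.
pose s i := eps / 2 * a i.
have := HC g^T s (rot_box g a `&` box b).
rewrite det_tr (proj2 gS) normr1 divr1 /s big_split/= prodr_const card_ord mulrA.
apply; rewrite ?oner_neq0//; first by move=> i; apply: mulr_gt0 => //; apply: divr_gt0.
move=> y Hy; split.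
  apply/(rot_boxE _ _ _ gS) => i; apply: le_trans (Hy i) _.
  by rewrite mulrAC ler_pM2r ?invr_gt0// ler_piMl// ltW.
apply/in_boxE => j.
have -> : y = g *m (g^T *m y) by rewrite mulmxA (proj1 gS) mul1mx.
apply: (@le_trans _ _ (d%:R * (kappa * eps) * (b j / 2))).
  apply: mulmx_entry_le => i.
  apply: (@le_trans _ _ (kappa * ((a i)^-1 * b j) * (eps / 2 * a i))).
    by rewrite ler_pM.
  by rewrite le_eqVlt; apply/orP; left; apply/eqP; field; rewrite gt_eqF.
by apply: ler_piMl; [rewrite divr_ge0// ltW|rewrite mulrA].
Qed.

(** The image of a singular [g] lies in a hyperplane orthogonal to some [v], so inside [[b]] it fits
    in slabs of arbitrarily small thickness. This controls the overlap event off SO, where it must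
    still be measurable. *)
Lemma overlap_singular {R : realType} (d : nat) (a b : 'I_d -> R) (g : 'M[R]_d) :
  (forall i, 0 < b i) -> \det g = 0 ->
  lebesgue_vol (rot_box g a `&` box b) = 0%E.
Proof.
move=> b0 /eqP/det0P[v v0 vg].
have [i vi] : exists i, v 0 i != 0.
  apply/existsP; apply: contraNT v0; rewrite negb_exists => /forallP H.
  by apply/eqP/rowP => i; rewrite mxE; apply/eqP; have := H i; rewrite negbK.
have [C C0 HC] := @lebesgue_vol_slabs_upper R d.
apply/eqP; rewrite eq_le; apply/andP; split; last first.
  by apply: iint_ge0 => x; rewrite lee_fin indicE.
apply/lee_addgt0Pr => e e0; rewrite add0e.
pose M : 'M[R]_d := \matrix_(k, l) if k == i then v 0 l else (k == l)%:R.
have dM : \det M = v 0 i by exact: det_id_row.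
have B0 : 0 < \prod_(k < d | k != i) b k by rewrite prodr_gt0.
have v0i : 0 < `|v 0 i| by rewrite normr_gt0.
(* The thickness for which the slab bound on the volume equals [e]. *)
pose t := e * `|v 0 i| / (C * \prod_(k < d | k != i) b k).
have t0 : 0 < t by rewrite divr_gt0 ?mulr_gt0.
pose s k := if k == i then t else b k.
have s0 k : 0 < s k by rewrite /s; case: ifP.
have := HC M s (rot_box g a `&` box b) s0; rewrite dM => /(_ vi) H.
apply: le_trans (H _) _.
  move=> y [[x _ <-] /in_boxE Hb] k; rewrite /s; case: ifPn => ki.
    suff -> : (M *m (g *m x)) k ord0 = 0 by rewrite normr0 ltW.
    have -> : (M *m (g *m x)) k ord0 = (v *m (g *m x)) 0 ord0.
      by rewrite !mxE; apply: eq_bigr => l _; rewrite [M k l]mxE ki.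
    by rewrite mulmxA vg mul0mx mxE.
  suff -> : (M *m (g *m x)) k ord0 = (g *m x) k ord0.
    by apply: le_trans (Hb k) _; have := b0 k; lra.
  rewrite mxE (bigD1 k)//= mxE (negPf ki) eqxx mul1r big1 ?addr0// => l lk.
  by rewrite mxE (negPf ki) eq_sym (negPf lk) mul0r.
rewrite lee_fin (bigD1 i)//= {1}/s eqxx.
have -> : \prod_(k < d | k != i) s k = \prod_(k < d | k != i) b k.
  by apply: eq_bigr => k /negPf ki; rewrite /s ki.
rewrite /t le_eqVlt; apply/orP; left; apply/eqP; field.
by rewrite !gt_eqF.
Qed.

(** Singular matrices are outside the event because [c1] is positive. On invertible ones, membership
    in the overlap is expressed through adjugate and determinant, which are polynomial in the
    entries, so the volume is a measurable function of [g]. *)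
Lemma measurable_big_overlap_event {R : realType} (d : nat) (a b : 'I_d -> R) (c1 c2 : R) :
  (forall i, 0 < a i) -> (forall i, 0 < b i) -> 0 < c1 ->
  measurable (big_overlap_event c1 c2 a b).
Proof.
move=> a0 b0 c10.
(* Cramer's rule cleared of denominators: [g^-1 x] lies in [[a]] exactly when these inequalities
   hold, provided the determinant is nonzero. *)
pose Phi (g : MBorel R d) (x : nat -> R) : \bar R :=
  (([forall i, `|(\adj (g : 'M[R]_d) *m vec_of d x) i ord0|
                 <= `|\det (g : 'M[R]_d)| * (a i / 2)] &&
    [forall i : 'I_d, `|x i| <= b i / 2])%:R)%:E.
have Phi0 g x : (0 <= Phi g x)%E by rewrite lee_fin.
have mPhi : jointly_measurable Phi.
  move=> dU U u x mu mx; apply: measurable_indicb.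
  have mg := measurable_mx_comp _ _ mu (@measurable_coord R d).
  apply: measurable_and; apply: measurable_forall => i; apply: measurable_norm_le => //.
    by apply: measurable_mx_mul; [exact: measurable_adj|exact: measurable_vec_of].
  apply: measurable_funM => //; apply: measurableT_comp => //.
  exact: measurable_det.
pose F (g : MBorel R d) := iint d (Phi g) (fun=> 0).
have mF : measurable_fun setT F.
  exact: (jointly_measurable_iint _ d Phi0 mPhi _ _ id (fun _ _ => 0)).
have volE (g : 'M[R]_d) : \det g != 0 -> lebesgue_vol (rot_box g a `&` box b) = F g.
  move=> dg; apply: eq_iint => x; congr EFin; rewrite indicE; congr ((nat_of_bool _)%:R).
  apply/idP/andP => [/set_mem [[z /in_boxE Hz zE] /in_boxE Hb]|[/forallP Ha /forallP Hb]].
    split; apply/forallP => i; last by have := Hb i; rewrite mxE.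
    by rewrite -zE mulmxA mul_adj_mx mul_scalar_mx mxE normrM ler_wpM2l.
  apply: mem_set; split; last by apply/in_boxE => i; rewrite mxE.
  exists ((\det g)^-1 *: (\adj g *m vec_of d x)).
    apply/in_boxE => i; rewrite mxE normrM normfV mulrC ler_pdivrMr ?normr_gt0//.
    by rewrite mulrC; exact: Ha.
  by rewrite -scalemxAr mulmxA mul_mx_adj mul_scalar_mx scalerA mulVf// scale1r.
have tv0 : 0 < tvol a by rewrite /tvol prodr_gt0.
have -> : big_overlap_event c1 c2 a b =
    [set g | \det (g : 'M[R]_d) != 0] `&`
    (F @^-1` [set` `[(c1 * tvol a)%:E, +oo[] `&` F @^-1` [set` `]-oo, (c2 * tvol a)%:E]]).
  apply/seteqP; split=> g.
    rewrite /big_overlap_event/= => -[].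
    have [dg|dg] := eqVneq (\det (g : 'M[R]_d)) 0.
      rewrite overlap_singular// lee_fin => H.
      by have := lt_le_trans (mulr_gt0 c10 tv0) H; rewrite ltxx.
    by rewrite volE// => H1 H2; rewrite !in_itv/= H1 H2.
  rewrite /big_overlap_event/= => -[dg]; rewrite !in_itv/= andbT => -[H1 H2].
  by rewrite volE.
apply: measurableI.
  rewrite [X in measurable X](_ : _ =
    setT `&` (fun g : MBorel R d => \det (g : 'M[R]_d)) @^-1` [set~ 0]); last first.
    by rewrite setTI; apply/seteqP; split=> g /= /eqP.
  apply: (measurable_det _ (@measurable_coord R d)) => //.
  exact/measurableC.
by apply: measurableI; rewrite -[_ @^-1` _]setTI; apply: mF => //; exact: emeasurable_itv.
Qed.

(** * Averaging over matrices *)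

Lemma iint_mx_upper {R : realType} (n : nat) : exists2 C : R, 0 < C &
  forall (h V B : 'M[R]_n) (c : R) (F : (nat -> R) -> \bar R),
  SO h -> (forall i j, 0 < B i j) -> 0 <= c -> (forall x, 0 <= F x)%E ->
  (forall x, F x <=
    (c * [forall i, forall j, `|(mx_of n n x *m h) i j - V i j| <= B i j]%:R)%:E)%E ->
  forall x, (iint (n * n) F x <= (c * (C * \prod_i \prod_j B i j))%:E)%E.
Proof.
have [C C0 HC] := @iint_slabs_upper R (n * n).
have N0 : 0 < (n * n)`!%:R :> R by rewrite ltr0n fact_gt0.
exists (C * (n * n)`!%:R); first exact: mulr_gt0.
move=> h V B c F hS B0 c0 F0 HF x.
have /andP[d1 _] := SO_lin_mulmxr_det _ hS.
have d0 : 0 < `|\det (lin_mulmxr h : 'M[R]_(n * n))|.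
  by apply: lt_le_trans d1; rewrite invr_gt0.
have dM : \det (lin_mulmxr h : 'M[R]_(n * n))^T != 0 by rewrite det_tr -normr_gt0.
have B0' p : 0 < mxvec B 0 p by case/mxvec_indexP: p => i j; rewrite mxvecE.
apply: le_trans (HC _ (mxvec V 0) (mxvec B 0) c F c0 B0' dM F0 _ x) _.
  by move=> y; rewrite in_slabs_mx.
rewrite lee_fin ler_wpM2l// prod_mxvec det_tr [X in _ <= X]mulrAC ler_wpM2l//.
  by rewrite mulr_ge0 ?ltW//; apply: prodr_gt0 => i _; exact: prodr_gt0.
by rewrite -[X in _ <= X]invrK lef_pV2 ?posrE ?invr_gt0.
Qed.

Lemma iint_mx_lower {R : realType} (n : nat) : exists2 C : R, 0 < C &
  forall (h V B : 'M[R]_n) (c : R) (F : (nat -> R) -> \bar R),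
  SO h -> (forall i j, 0 < B i j) -> 0 <= c ->
  (forall x,
    (c * [forall i, forall j, `|(mx_of n n x *m h) i j - V i j| <= B i j]%:R)%:E
    <= F x)%E ->
  forall x, ((c * (C * \prod_i \prod_j B i j))%:E <= iint (n * n) F x)%E.
Proof.
have [C C0 HC] := @iint_slabs_lower R (n * n).
have N0 : 0 < (n * n)`!%:R :> R by rewrite ltr0n fact_gt0.
exists (C / (n * n)`!%:R); first exact: divr_gt0.
move=> h V B c F hS B0 c0 HF x.
have /andP[d1 d2] := SO_lin_mulmxr_det _ hS.
have d0 : 0 < `|\det (lin_mulmxr h : 'M[R]_(n * n))|.
  by apply: lt_le_trans d1; rewrite invr_gt0.
have dM : \det (lin_mulmxr h : 'M[R]_(n * n))^T != 0 by rewrite det_tr -normr_gt0.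
have B0' p : 0 < mxvec B 0 p by case/mxvec_indexP: p => i j; rewrite mxvecE.
apply: le_trans (HC _ (mxvec V 0) (mxvec B 0) c F c0 B0' dM _ x).
  rewrite lee_fin ler_wpM2l// prod_mxvec det_tr mulrAC ler_wpM2l//; last first.
    by rewrite lef_pV2 ?posrE.
  by rewrite mulr_ge0 ?ltW//; apply: prodr_gt0 => i _; exact: prodr_gt0.
by move=> y; rewrite in_slabs_mx.
Qed.

(** Phrased with inequalities of norms so that measurability reduces to [measurable_norm_le]. *)
Definition SOb {R : realType} {n : nat} (g : 'M[R]_n) : bool :=
  [forall i, forall j, `|(g *m g^T) i j - (i == j)%:R| <= 0] && (`|\det g - 1| <= 0).

Lemma SObP {R : realType} {n : nat} (g : 'M[R]_n) : reflect (SO g) (SOb g).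
Proof.
apply: (iffP andP) => [[/'forall_forallP H]|[gg dg]].
  rewrite normr_le0 subr_eq0 => /eqP dg; split=> //; apply/matrixP => i j.
  by have := H i j; rewrite normr_le0 subr_eq0 => /eqP ->; rewrite mxE.
split; last by rewrite dg subrr normr0.
by apply/'forall_forallP => i j; rewrite gg mxE subrr normr0.
Qed.

Lemma measurable_SOb {R : realType} {dT : measure_display} {T : measurableType dT}
    {n : nat} (g : T -> 'M[R]_n) :
  measurable_mx g -> measurable_fun setT (fun w => SOb (g w)).
Proof.
move=> mg; apply: measurable_and.
  do 2![apply: measurable_forall => ?]; apply: measurable_norm_le => //.
  apply: measurable_funB => //; apply: measurable_mx_mul => // i j.
  by under eq_fun do rewrite mxE; exact: mg.
by apply: measurable_norm_le => //; apply: measurable_funB => //; exact: measurable_det.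
Qed.

Lemma measurable_set_bool {dT : measure_display} {T : measurableType dT} (b : T -> bool) :
  measurable_fun setT b -> measurable [set t | b t].
Proof.
move=> mb; have -> : [set t | b t] = setT `&` b @^-1` [set true].
  by rewrite setTI; apply/seteqP; split=> t /=.
exact: mb.
Qed.

Lemma integral_bool {R : realType} {dT : measure_display} {T : measurableType dT}
    (P : {measure set T -> \bar R}) (b : T -> bool) : measurable_fun setT b ->
  (\int[P]_t ((b t)%:R)%:E = P [set t | b t])%E.
Proof.
move=> /measurable_set_bool mb; rewrite -[in RHS](setIT [set t | b t]) -integral_indic//.
apply: eq_integral => t _; rewrite indicE; congr ((nat_of_bool _)%:R%:E).
by apply/idP/idP => [bt|/set_mem]; [exact: mem_set|].
Qed.

Definition haar_box {R : realType} {n : nat} (k : R) (m : 'M[R]_n) : set (MBorel R n) :=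
  [set g | SO g /\ forall i j, `|(g : 'M[R]_n) i j| <= k * m i j].

(** The set of pairs for the double count. The centre [V] is 0 for the upper Haar bound and the
    identity for the lower one. *)
Definition hits {R : realType} {n : nat} (V B : 'M[R]_n) (h : MBorel R n)
    (x : nat -> R) : bool :=
  SOb (h : 'M[R]_n) &&
  [forall i, forall j, `|(mx_of n n x *m (h : 'M[R]_n)) i j - V i j| <= B i j].

Lemma measurable_hits {R : realType} {n : nat} (V B : 'M[R]_n)
    {dU : measure_display} {U : measurableType dU} (u : U -> MBorel R n)
    (x : U -> nat -> R) :
  measurable_fun setT u -> (forall i, measurable_fun setT (fun w => x w i)) ->
  measurable_fun setT (fun w => hits V B (u w) (x w)).
Proof.
move=> mu mx; have mg := measurable_mx_comp _ _ mu (@measurable_coord R n).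
apply: measurable_and; first exact: (measurable_SOb _ mg).
do 2![apply: measurable_forall => ?]; apply: measurable_norm_le => //.
apply: measurable_funB => //; apply: measurable_mx_mul => //.
by move=> i j; rewrite /mx_of; under eq_fun do rewrite !mxE; exact: mx.
Qed.

Lemma hits_swap {R : realType} {n : nat} (V B : 'M[R]_n) (P : probability (MBorel R n) R) :
  (iint (n * n) (fun y => P [set h | hits V B h y]) (fun=> 0%R) =
   \int[P]_h iint (n * n) (fun y => ((hits V B h y)%:R)%:E) (fun=> 0%R))%E.
Proof.
rewrite -(iint_integral_swap P (fun h y => ((hits V B h y)%:R)%:E)).
- apply: eq_iint => y; rewrite integral_bool//.
  by apply: (measurable_hits _ _ id (fun=> y)).
- by move=> h x; rewrite lee_fin.
- by move=> dU U u x mu mx; apply: measurable_indicb; exact: measurable_hits.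
Qed.

(** After the exchange of integrals, the inner integral over matrices is bounded by the volume of
    the box for [h] in SO and is zero for other [h]. *)
Lemma hits_average_upper {R : realType} (n : nat) : exists2 C : R, 0 < C &
  forall (V B : 'M[R]_n) (P : probability (MBorel R n) R),
  (forall i j, 0 < B i j) ->
  (iint (n * n) (fun y => P [set h | hits V B h y]) (fun=> 0%R)
    <= (C * \prod_i \prod_j B i j)%:E)%E.
Proof.
have [C C0 HC] := @iint_mx_upper R n; exists C => // V B P B0.
rewrite hits_swap.
have B0' : 0 <= C * \prod_i \prod_j B i j.
  apply: mulr_ge0; first exact: ltW.
  by apply/ltW; apply: prodr_gt0 => i _; exact: prodr_gt0.
apply: (@le_trans _ _ (\int[P]_h cst (C * \prod_i \prod_j B i j)%:E h)%E); last first.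
  by rewrite integral_cst// [X in (_ * X)%E](_ : _ = 1%E) ?mule1//; exact: probability_setT.
apply: integral_mono => h.
  by apply: iint_ge0 => x; rewrite lee_fin.
have [/SObP hS|hS] := boolP (SOb (h : 'M[R]_n)).
  rewrite /cst -[X in (_ <= X%:E)%E]mul1r; apply: (HC h V B 1 _ hS B0 ler01) => x.
    by rewrite lee_fin.
  by rewrite lee_fin mul1r /hits; case: SOb => //=.
have -> : (fun y => ((hits V B h y)%:R : R)%:E) = (fun=> 0%E).
  by apply/funext => y; rewrite /hits (negPf hS).
suff -> : iint (n * n) (fun=> 0%E) (fun=> 0%R) = 0%E :> \bar R by rewrite lee_fin.
have iint0 k x : iint k (fun=> 0%E) x = 0%E :> \bar R.
  by elim: k x => //= k IH x; under eq_integral do rewrite IH; rewrite integral0.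
exact: iint0.
Qed.

Lemma hits_average_lower {R : realType} (n : nat) : exists2 C : R, 0 < C &
  forall (V B : 'M[R]_n) (P : probability (MBorel R n) R),
  P (@SO R n : set (MBorel R n)) = 1%E ->
  (forall i j, 0 < B i j) ->
  ((C * \prod_i \prod_j B i j)%:E <=
    iint (n * n) (fun y => P [set h | hits V B h y]) (fun=> 0%R))%E.
Proof.
have [C C0 HC] := @iint_mx_lower R n; exists C => // V B P PSO B0.
rewrite hits_swap; set c := C * _.
have c0 : 0 <= c.
  apply: mulr_ge0; first exact: ltW.
  by apply/ltW; apply: prodr_gt0 => i _; exact: prodr_gt0.
have mS : measurable_fun setT (fun h : MBorel R n => SOb (h : 'M[R]_n)).
  exact: (measurable_SOb _ (@measurable_coord R n)).
apply: (@le_trans _ _ (\int[P]_h (c%:E * ((SOb (h : 'M[R]_n))%:R)%:E))%E).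
  rewrite ge0_integralZl_EFin//; last exact: measurable_indicb.
  rewrite integral_bool//.
  have -> : [set h : MBorel R n | SOb (h : 'M[R]_n)] = @SO R n.
    by apply/seteqP; split=> h /= /SObP.
  by rewrite [X in (_ <= _ * X)%E]PSO mule1.
apply: integral_mono => h; first by rewrite mule_ge0 ?lee_fin.
have [/SObP hS|hS] := boolP (SOb (h : 'M[R]_n)).
  rewrite mule1 -[c]mul1r; apply: (HC h V B 1 _ hS B0 ler01) => x.
  by rewrite mul1r /hits; move/SObP: hS => ->.
by rewrite mule0; apply: iint_ge0 => x; rewrite lee_fin.
Qed.

(** * The Haar measure of anisotropic boxes *)

Lemma measurable_haar_box_preimage {R : realType} {dT : measure_display}
    {T : measurableType dT} (n : nat) (k : R) (m : 'M[R]_n) (g : T -> 'M[R]_n) :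
  measurable_mx g -> measurable [set w | haar_box k m (g w)].
Proof.
move=> mg.
have -> : [set w | haar_box k m (g w)] = [set w | SOb (g w) &&
    [forall i, forall j, `|g w i j| <= k * m i j]].
  apply/seteqP; split=> w /=.
    by move=> [/SObP -> H]; apply/'forall_forallP.
  by move=> /andP[/SObP gS /'forall_forallP H].
apply: measurable_set_bool; apply: measurable_and; first exact: measurable_SOb.
by do 2![apply: measurable_forall => ?]; apply: measurable_norm_le.
Qed.

Lemma measurable_haar_box {R : realType} (n : nat) (k : R) (m : 'M[R]_n) :
  measurable (haar_box k m).
Proof. exact: (measurable_haar_box_preimage _ _ _ _ (@measurable_coord R n)). Qed.

Lemma measurable_haar_box_translate {R : realType} (n : nat) (k : R) (m q : 'M[R]_n) :
  measurable ((fun h : MBorel R n => (q *m h : MBorel R n)) @^-1` haar_box k m).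
Proof.
apply: (measurable_haar_box_preimage _ _ _ (fun h : MBorel R n => q *m (h : 'M[R]_n))).
apply: measurable_mx_mul; first exact: measurable_mx_cst.
exact: measurable_coord.
Qed.

Lemma measurable_hits_set {R : realType} (n : nat) (V B : 'M[R]_n) (y : nat -> R) :
  measurable [set h | hits V B h y].
Proof. by apply: measurable_set_bool; apply: (measurable_hits _ _ id (fun=> y)). Qed.

Definition row_antitone {R : realType} {n : nat} (m : 'M[R]_n) : Prop :=
  forall i j k : 'I_n, (i <= j)%N -> m j k <= m i k.

(* Left multiplication by an upper triangular matrix adds to each row multiples of
   the rows below it, where the tolerances [m] are smaller. *)
Lemma upper_trig_mul_le {R : realType} {n : nat} (T y m : 'M[R]_n) (t k : R) :
  row_antitone m -> upper_trig T -> 0 <= t -> 0 <= k -> (forall i j, 0 < m i j) ->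
  (forall i j, `|T i j| <= t) -> (forall i j, `|y i j| <= k * m i j) ->
  forall i j, `|(T *m y) i j| <= n%:R * (t * k) * m i j.
Proof.
move=> am uT t0 k0 m0 hT hy i j; apply: mulmx_entry_le => l.
have [li|il] := ltnP l i.
  by rewrite uT// normr0 mul0r !mulr_ge0// ltW.
rewrite -mulrA ler_pM//; apply: le_trans (hy l j) _.
by rewrite ler_wpM2l// am.
Qed.

Lemma prod_scale {R : realType} {n : nat} (r : R) (m : 'M[R]_n) :
  \prod_i \prod_j (r *: m) i j = (r ^+ n) ^+ n * \prod_i \prod_j m i j.
Proof.
transitivity (\prod_(i < n) (r ^+ n * \prod_j m i j)).
  apply: eq_bigr => i _; under eq_bigr do rewrite mxE.
  by rewrite big_split/= prodr_const card_ord.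
by rewrite big_split/= prodr_const card_ord.
Qed.

Lemma SO1 {R : realType} {n : nat} : SO (1%:M : 'M[R]_n).
Proof. by split; rewrite ?trmx1 ?mulmx1 ?det1. Qed.

(** For every [x = T q] near the identity, [T] is bounded, so [q h] in the Haar box forces
    [x h = T (q h)] into the box [r *: m]. By left invariance each such [x] contributes at least
    [P (haar_box k m)], while the total is bounded by [hits_average_upper]. *)
Lemma haar_box_upper {R : realType} (n : nat) (k : R) : 0 < k ->
  exists2 K : R, 0 < K &
  forall (m : 'M[R]_n.+1) (P : probability (MBorel R n.+1) R),
  haar_SO P -> (forall i j, 0 < m i j) -> row_antitone m ->
  (P (haar_box k m) <= (K * \prod_i \prod_j m i j)%:E)%E.
Proof.
move=> k0; have [C C0 HC] := @hits_average_upper R n.+1.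
have [c c0 Hc] := @iint_mx_lower R n.+1.
have N0 : 0 < n.+1%:R :> R by rewrite ltr0n.
have N1 : 1 <= n.+1%:R :> R by rewrite ler1n.
pose eta : R := (2 * n.+1%:R)^-1.
have eta0 : 0 < eta by rewrite invr_gt0 mulr_gt0.
have eta1 : eta <= 1 by rewrite /eta invf_le1; lra.
(* The inner factor bounds the entries of [T = X q^T], as those of [X] are at most 2; the outer one
   counts the terms in a product with [T]. *)
pose r : R := n.+1%:R * (n.+1%:R * (2 * 1) * k).
have r0 : 0 < r by rewrite !mulr_gt0.
pose E : 'M[R]_n.+1 := const_mx eta.
have E0 : 0 < c * \prod_i \prod_j E i j.
  by apply: mulr_gt0 => //; do 2![apply: prodr_gt0 => ? _]; rewrite mxE.
exists (C * (r ^+ n.+1) ^+ n.+1 / (c * \prod_i \prod_j E i j)).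
  by rewrite divr_gt0// mulr_gt0// !exprn_gt0.
move=> m P [PSO Pinv] m0 am.
have Pfin : P (haar_box k m) \is a fin_num.
  by apply: fin_num_measure; exact: measurable_haar_box.
rewrite -(fineK Pfin) lee_fin; set p := fine _.
have p0 : 0 <= p by exact: fine_ge0.
rewrite mulrAC ler_pdivlMr// -mulrA -prod_scale -lee_fin.
apply: le_trans (HC 0 (r *: m) P _); last by move=> i j; rewrite mxE mulr_gt0.
apply: (Hc 1%:M 1%:M E p _ SO1) => // [i j|x]; first by rewrite mxE.
case: (boolP [forall i, _]) => [/'forall_forallP Hx|_]; last by rewrite mulr0.
rewrite mulr1 fineK//; set X := mx_of _ _ _ in Hx.
have {}Hx i j : `|X i j - (i == j)%:R| <= eta.
  by have := Hx i j; rewrite mulmx1 !mxE.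
have [T [S [q [uT uS ST qS XE]]]] := RQ_decomposition _ _ (near_id_det _ Hx).
have X2 i j : `|X i j| <= 2.
  rewrite -[X i j](subrK (i == j)%:R); apply: le_trans (ler_normD _ _) _.
  have := Hx i j; have : `|(i == j)%:R| <= 1 :> R by case: (i == j); rewrite ?normr1 ?normr0.
  lra.
have T2 i j : `|T i j| <= n.+1%:R * (2 * 1).
  have -> : T = X *m q^T by rewrite XE -mulmxA (proj1 qS) mulmx1.
  rewrite -[X in _ <= X]mulr1; apply: mulmx_entry_le => l.
  rewrite mulr1 ler_pM// mxE; exact: orthogonal_entry_le1 (proj1 qS).
(* Left invariance replaces the Haar box by the set of [h] with [q h] in it. *)
rewrite -(Pinv q qS _ (measurable_haar_box _ k m)).
apply: le_measure; rewrite ?inE//.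
- exact: measurable_haar_box_translate.
- exact: measurable_hits_set.
move=> h /= [qhS Hh]; apply/andP; split.
  apply/SObP; have -> : h = q^T *m (q *m h) :> 'M[R]_n.+1.
    by rewrite mulmxA SO_trmul// mul1mx.
  by apply: SO_mul => //; exact: SO_tr.
apply/'forall_forallP => i j; rewrite -/X [X in `|_ - X|]mxE subr0 XE -mulmxA [X in _ <= X]mxE.
by apply: upper_trig_mul_le => //; exact: ltW.
Qed.

(** The double count is run with [x h] close to the identity, which makes [x] invertible and the
    inverse [S] of its triangular factor bounded. Then [q h = S (x h)] lies in a Haar box, so each
    [x] contributes at most [P (haar_box k m)], and only [x] in a fixed bounded set contribute. *)
Lemma haar_box_lower {R : realType} (n : nat) (gamma : R) : 0 < gamma ->
  exists k K : R, [/\ 0 < k, 0 < K &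
  forall (m : 'M[R]_n.+1) (P : probability (MBorel R n.+1) R),
  haar_SO P -> (forall i j, 0 < m i j) -> (forall i j, m i j <= 1) ->
  (forall i, gamma <= m i i) -> row_antitone m ->
  ((K * \prod_i \prod_j m i j)%:E <= P (haar_box k m))%E].
Proof.
move=> g0; have [C C0 HC] := @hits_average_lower R n.+1.
have [c c0 Hc] := @iint_mx_upper R n.+1.
have N0 : 0 < n.+1%:R :> R by rewrite ltr0n.
have N1 : 1 <= n.+1%:R :> R by rewrite ler1n.
pose eta : R := (2 * n.+1%:R)^-1.
have eta0 : 0 < eta by rewrite invr_gt0 mulr_gt0.
have eta1 : eta <= 1 by rewrite /eta invf_le1; lra.
pose D : 'M[R]_n.+1 := const_mx (n.+1%:R * (2 * 1)).
have D0 : 0 < c * \prod_i \prod_j D i j.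
  by apply: mulr_gt0 => //; do 2![apply: prodr_gt0 => ? _]; rewrite mxE !mulr_gt0.
(* Combines the bound 2 on the entries of [S] with the bound [2 / gamma * m] on those of [x h]. *)
pose k := n.+1%:R * ((2 * 1) * (2 / gamma)).
have k0 : 0 < k by rewrite !mulr_gt0 ?invr_gt0.
exists k, (C * (eta ^+ n.+1) ^+ n.+1 / (c * \prod_i \prod_j D i j)).
split=> //; first by rewrite divr_gt0// mulr_gt0// !exprn_gt0.
move=> m P [PSO Pinv] m0 m1 mg am.
have Pfin : P (haar_box k m) \is a fin_num.
  by apply: fin_num_measure; exact: measurable_haar_box.
rewrite -(fineK Pfin) lee_fin; set p := fine _.
have p0 : 0 <= p by exact: fine_ge0.
rewrite mulrAC ler_pdivrMr// -mulrA -prod_scale -lee_fin.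
apply: le_trans (HC 1%:M (eta *: m) P PSO _) _.
  by move=> i j; rewrite mxE mulr_gt0.
apply: (Hc 1%:M 0 D p _ SO1) => // [i j|x]; first by rewrite mxE !mulr_gt0.
set X := mx_of _ _ x.
have hitsP h : hits 1%:M (eta *: m) h x ->
    SO (h : 'M[R]_n.+1) /\ forall i j, `|(X *m h) i j - (i == j)%:R| <= eta * m i j.
  move=> /andP[/SObP hS /'forall_forallP H]; split=> // i j.
  by have := H i j; rewrite -/X [X in `|_ - X|]mxE [X in _ <= X]mxE.
have near y : (forall i j, `|y i j - (i == j)%:R| <= eta * m i j) ->
    forall i j : 'I_n.+1, `|y i j - (i == j)%:R| <= eta.
  move=> H i j; apply: le_trans (H i j) _.
  by rewrite ler_piMr// ltW.
have near2 (y : 'M[R]_n.+1) : (forall i j, `|y i j - (i == j)%:R| <= eta * m i j) ->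
    forall i j : 'I_n.+1, `|y i j| <= 2 / gamma * m i j.
  move=> H i j; rewrite -[y i j](subrK (i == j)%:R).
  apply: le_trans (ler_normD _ _) _.
  have gm : gamma <= 1 by apply: le_trans (mg ord0) _.
  (* The lower bound [gamma] on the diagonal of [m] absorbs the ones of the identity matrix. *)
  have eq_m : `|(i == j)%:R| <= m i j / gamma.
    case: eqP => [<-|_]; last by rewrite normr0 divr_ge0// ltW.
    by rewrite normr1 ler_pdivlMr// mul1r.
  have : eta * m i j <= m i j / gamma.
    rewrite mulrC ler_pM2l//; apply: le_trans eta1 _.
    by rewrite -[X in X <= _]invr1 lef_pV2 ?posrE.
  have := H i j; have -> : 2 / gamma * m i j = m i j / gamma + m i j / gamma by ring.
  lra.
have [[h0 /hitsP[h0S Hh0]]|none] := pselect (exists h, hits 1%:M (eta *: m) h x); last first.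
  have -> : [set h | hits 1%:M (eta *: m) h x] = set0.
    by apply/seteqP; split=> h //= hh; apply: none; exists h.
  by rewrite measure0 lee_fin mulr_ge0.
have dX : \det X != 0.
  by have := near_id_det _ (near _ Hh0); rewrite det_mulmx (proj2 h0S) mulr1.
have [T [S [q [uT uS ST qS XE]]]] := RQ_decomposition _ _ dX.
have SX (h : 'M[R]_n.+1) : S *m (X *m h) = q *m h by rewrite XE !mulmxA ST mul1mx.
(* A single hit [h0] suffices: [S (X h0) = q h0] has entries at most 1 and [X h0] is near the
   identity. As [S] depends on [x] only, the bound then serves every [h]. *)
have S2 i j : `|S i j| <= 2 * 1.
  apply: near_id_bound (near _ Hh0) _ i j => i j; rewrite SX.
  by apply: orthogonal_entry_le1; exact: proj1 (SO_mul _ _ qS h0S).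
have -> : [forall i, forall j, `|(X *m 1%:M) i j - (0 : 'M[R]_n.+1) i j| <= D i j].
  apply/'forall_forallP => i j; rewrite mulmx1 [X in `|_ - X|]mxE subr0 [X in _ <= X]mxE.
  have -> : X = (X *m h0) *m h0^T by rewrite -mulmxA (proj1 h0S) mulmx1.
  rewrite -[X in _ <= X]mulr1; apply: mulmx_entry_le => l.
  rewrite mulr1 ler_pM//; last first.
    by rewrite mxE; exact: orthogonal_entry_le1 (proj1 h0S).
  rewrite -[(X *m h0) i l](subrK (i == l)%:R); apply: le_trans (ler_normD _ _) _.
  have := near _ Hh0 i l.
  have : `|(i == l)%:R| <= 1 :> R by case: (i == l); rewrite ?normr1 ?normr0.
  lra.
rewrite mulr1 fineK// -(Pinv q qS _ (measurable_haar_box _ k m)).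
apply: le_measure; rewrite ?inE//.
- exact: measurable_hits_set.
- exact: measurable_haar_box_translate.
move=> h /= /hitsP[hS Hh]; split; first exact: SO_mul.
move=> i j; rewrite -SX.
apply: upper_trig_mul_le => //; last exact: near2.
by rewrite divr_ge0// ltW.
Qed.

(** * Comparison of the overlap event with Haar boxes *)

Lemma dyadic_gt0 {R : realType} (x : R) : dyadic x -> 0 < x.
Proof. by move=> [k ->]; rewrite exprz_gt0. Qed.

(** SO has full measure, so an inclusion checked on SO is enough; the overlap event yields entry
    bounds only for [g] in SO. *)
Lemma haar_SO_le {R : realType} (n : nat) (P : probability (MBorel R n) R)
    (E F : set (MBorel R n)) :
  haar_SO P -> measurable E -> measurable F ->
  (forall g, SO (g : 'M[R]_n) -> E g -> F g) -> (P E <= P F)%E.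
Proof.
move=> [PSO _] mE mF EF.
have mSO : measurable (@SO R n : set (MBorel R n)).
  have -> : (@SO R n : set (MBorel R n)) = [set g | SOb (g : 'M[R]_n)].
    by apply/seteqP; split=> g /= /SObP.
  apply: measurable_set_bool; exact: (measurable_SOb _ (@measurable_coord R n)).
have PC : P (~` (@SO R n : set (MBorel R n))) = 0%E.
  by rewrite probability_setC// [X in (_ - X)%E]PSO subee.
apply: (@le_trans _ _ (P (F `|` ~` (@SO R n : set (MBorel R n))))).
  apply: le_measure; rewrite ?inE//; first by apply: measurableU => //; exact: measurableC.
  move=> g Eg; have [gS|gS] := pselect (SO (g : 'M[R]_n)); [left; exact: EF|by right].
apply: le_trans (measureU2 _ mF (measurableC mSO)) _.
by rewrite [X in (_ + X)%E]PC adde0.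
Qed.

Theorem lemma4p1 (d : nat) (C0 : Rdefinitions.R) :
  (1 <= d)%N -> 0 < C0 ->
  exists c1 c2 K : Rdefinitions.R,
    [/\ 0 < c1, 0 < c2, 0 < K &
    forall (a b : 'I_d -> Rdefinitions.R)
           (P : probability (MBorel Rdefinitions.R d) Rdefinitions.R),
      dyadic_tuple a -> dyadic_tuple b ->
      nonincreasing_tuple a -> nonincreasing_tuple b ->
      (forall i : 'I_d, a i <= C0 * b i) ->
      haar_SO P ->
      ((K^-1 * Iab a b)%:E <= P (big_overlap_event c1 c2 a b))%E /\
      (P (big_overlap_event c1 c2 a b) <= (K * Iab a b)%:E)%E].
Proof.
case: d => [//|d] _ C00.
set R := Rdefinitions.R in C0 C00 *.
(* The hypothesis [a i <= C0 * b i] bounds the diagonal of [m] below by this number. *)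
have gam0 : 0 < Num.min C0^-1 1 by rewrite lt_min invr_gt0 C00 ltr01.
have [k [Kl [k0 Kl0 Hlow]]] := haar_box_lower d _ gam0.
have [c1 c10 Hc1] := overlap_lower d.+1 _ k0.
have [c2 c20 Hc2] := @overlap_upper R d.+1.
(* The term [c2 / c1] handles entries where the minimum is the ratio [b j / a i]; the added 1
   handles those where it is 1, since [|g j i| <= 1]. *)
have k'0 : 0 < c2 / c1 + 1 by rewrite addr_gt0// divr_gt0.
have [Ku Ku0 Hup] := haar_box_upper d _ k'0.
exists c1, c2, (Ku + Kl^-1); split=> //.
  by rewrite addr_gt0// invr_gt0.
move=> a b P /(_ _)/dyadic_gt0 a0 /(_ _)/dyadic_gt0 b0 na nb ab haarP.
(* Rows are indexed by [b], so that monotonicity of [b] makes [m] row-antitone. *)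
pose m : 'M[R]_d.+1 := \matrix_(j, i) Num.min ((a i)^-1 * b j) 1.
have ab0 i j : 0 < (a i)^-1 * b j by rewrite mulr_gt0// invr_gt0.
have m0 j i : 0 < m j i by rewrite mxE lt_min ab0 ltr01.
have m1 j i : m j i <= 1 by rewrite mxE ge_min lexx orbT.
have mab j i : m j i <= (a i)^-1 * b j by rewrite mxE ge_min lexx.
have am : row_antitone m.
  move=> i j l ij; rewrite !mxE le_min !ge_min lexx orbT andbT.
  by rewrite ler_pM2l ?invr_gt0// nb.
have mdiag i : Num.min C0^-1 1 <= m i i.
  rewrite mxE le_min !ge_min lexx orbT andbT.
  by rewrite -[X in X <= _]div1r ler_pdivrMr// -mulrA ler_pdivlMl// mulr1 mulrC ab.
have IE : Iab a b = \prod_i \prod_j m i j.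
  rewrite /Iab exchange_big/=; apply: eq_bigr => j _; apply: eq_bigr => i _.
  by rewrite mxE.
have I0 : 0 <= Iab a b.
  by rewrite IE; apply/ltW; apply: prodr_gt0 => j _; apply: prodr_gt0.
have mE := measurable_big_overlap_event d.+1 a b c1 c2 a0 b0 c10.
split.
  apply: (@le_trans _ _ (P (haar_box k m))).
    apply: le_trans (Hlow m P haarP m0 m1 mdiag am).
    rewrite lee_fin -IE ler_wpM2r// -[X in _ <= X]invrK lef_pV2 ?posrE ?invr_gt0//.
      by rewrite lerDr ltW.
    by rewrite addr_gt0// invr_gt0.
  apply: le_measure; rewrite ?inE//; first exact: measurable_haar_box.
  move=> g [gS Hg]; split; last by case: (Hc2 a b g a0 b0 gS).
  apply: Hc1 => // i j; apply: le_trans (Hg j i) _.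
  by rewrite ler_wpM2l// ltW.
apply: (@le_trans _ _ (P (haar_box (c2 / c1 + 1) m))).
  apply: haar_SO_le => //; first exact: measurable_haar_box.
  move=> g gS [Eg _]; split=> // j i.
  have [_ /(_ c1 c10 Eg i j) H] := Hc2 a b g a0 b0 gS.
  have g1 : `|(g : 'M[R]_d.+1) j i| <= 1 by exact: orthogonal_entry_le1 (proj1 gS).
  have q0 : 0 < c2 / c1 by rewrite divr_gt0.
  rewrite mxE; case: (leP ((a i)^-1 * b j) 1) => _; last by rewrite mulr1; lra.
  by apply: le_trans H _; rewrite ler_pM2r// lerDl.
apply: le_trans (Hup m P haarP m0 am) _.
by rewrite lee_fin -IE ler_wpM2r// lerDl invr_ge0 ltW.
Qed.
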